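(* Let $X$ be an integrable random vector in $\mathbb{R}^d$ satisfying $\mathbb{E}[X]=0$ and $$\mathbb{P}(|\langle v,X\rangle|>t)\le2e^{-t^2/2}\qquad\text{for all }v\in\mathbb{R}^d\text{ with }\|v\|_2=1\text{ and all }t\ge0.$$ Let $G\sim\mathcal{N}(0,I_d)$. Let $f:\mathbb{R}^d\to\mathbb{R}$ be a measurable function that either admits a representation $$f(x)=b+a^\top x+\sum_{k=1}^m\lambda_k\,\phi_k(\langle u_k,x\rangle)$$ with $m\in\mathbb{N}$, $a,u_k\in\mathbb{R}^d$, $b\in\mathbb{R}$, $\lambda_k\ge0$, and each $\phi_k:\mathbb{R}\to\mathbb{R}$ convex, or is a pointwise increasing limit of a sequence of functions of this form. Then $$\mathbb{E}[f(X)]\le\mathbb{E}[f(c_0G)],$$ where $c_0$ is the constant defined in the context and both sides are understood as extended expectations in $(-\infty,\infty]$.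
   Context: Let $\varphi(x)=(2\pi)^{-1/2}e^{-x^2/2}$ and $\overline{\Phi}(x)=\int_x^\infty\varphi(t)\,\mathrm{d}t$. The constant $c_0$ is defined as follows. Let $t_0=\sqrt{2\log 2}$, $A=\int_0^\infty \min\{1,2e^{-t^2/2}\}\,\mathrm{d}t=t_0+2\int_{t_0}^\infty e^{-t^2/2}\,\mathrm{d}t$, and $B=A/2$. For $x\ge t_0$ let $H(x)=2xe^{-x^2/2}+2\int_x^\infty e^{-t^2/2}\,\mathrm{d}t$; $H$ is strictly decreasing with $H(t_0)=A$ and $H(x)\to0$ as $x\to\infty$, so there is a unique $\bar a>t_0$ with $H(\bar a)=B$. Put $p_0=2e^{-\bar a^2/2}\in(0,1)$, let $z$ be the unique real solution of $\overline{\Phi}(z)=p_0$, and set $c_0=B/\varphi(z)$. *)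

(* Defs.v *)
(* MathComp-Analysis *)
From HB Require Import structures.
From mathcomp Require Export all_boot all_order all_algebra.
From mathcomp Require Export all_classical all_reals all_analysis.

Set Implicit Arguments.
Unset Strict Implicit.
Unset Printing Implicit Defensive.

Import Order.TTheory GRing.Theory Num.Theory.
Import numFieldNormedType.Exports.

Local Open Scope classical_set_scope.
Local Open Scope ring_scope.

(* R^d is [d.-tuple R], which the library equips with the sigma-algebra
   generated by the coordinate projections, i.e. the Borel sigma-algebra. *)
Section Vectors.
Context {R : realType} {d : nat}.

Definition dotp (u x : d.-tuple R) : R := \sum_(i < d) tnth u i * tnth x i.

Definition norm2 (v : d.-tuple R) : R := Num.sqrt (dotp v v).

Definition scalev (c : R) (x : d.-tuple R) : d.-tuple R :=
  [tuple c * tnth x i | i < d].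

Definition ridge_convex (g : d.-tuple R -> R) : Prop :=
  exists (m : nat) (a : d.-tuple R) (b : R) (u : 'I_m -> d.-tuple R)
         (lam : 'I_m -> R) (phi : 'I_m -> R -> R),
    [/\ forall k, 0 <= lam k,
        forall k, convex_function [set: R^o] (phi k)
      & forall x, g x = b + dotp a x + \sum_(k < m) lam k * phi k (dotp (u k) x)].

Definition increasing_limit_ridge_convex (f : d.-tuple R -> R) : Prop :=
  exists g : nat -> d.-tuple R -> R,
    [/\ forall n, ridge_convex (g n),
        forall x, nondecreasing_seq (fun n => g n x)
      & forall x, g n x @[n --> \oo] --> f x].

End Vectors.

Section RandomVectors.
Context {R : realType} {d : nat} {dT : measure_display} {T : measurableType dT}.
Variable P : probability T R.

Definition integrable_vector (X : T -> d.-tuple R) : Prop :=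
  forall i : 'I_d, P.-integrable [set: T] (fun w => (tnth (X w) i)%:E).

Definition centered (X : T -> d.-tuple R) : Prop :=
  forall i : 'I_d, ('E_P[fun w => tnth (X w) i] = 0)%E.

Definition subgaussian_tails (X : T -> d.-tuple R) : Prop :=
  forall v : d.-tuple R, norm2 v = 1 -> forall t : R, 0 <= t ->
    (P [set w | t < `|dotp v (X w)|]%R <= (2 * expR (- (t ^+ 2 / 2)))%:E)%E.

(* N(0, I_d): the coordinates are independent with law N(0, 1), i.e. the law of
   G agrees with the d-fold product of N(0, 1) on measurable rectangles (taking
   all but one of the [A i] to be the full line gives the marginals). *)
Definition standard_gaussian (G : T -> d.-tuple R) : Prop :=
  forall A : 'I_d -> set R, (forall i, measurable (A i)) ->
    (P [set w | forall i, A i (tnth (G w) i)] =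
      \prod_(i < d) normal_prob (0 : R) 1 (A i))%E.

End RandomVectors.

Section Constant.
Variable R : realType.
Local Notation mu := lebesgue_measure.

Definition gauss_density (x : R) : R := normal_pdf 0 1 x.

Lemma gauss_densityE (x : R) :
  gauss_density x = (Num.sqrt (2 * pi))^-1 * expR (- (x ^+ 2 / 2)).
Proof.
rewrite /gauss_density normal_pdfE ?oner_neq0// /normal_peak.
by rewrite /normal_fun subr0 !expr1n mul1r mulr_natl mulNr.
Qed.

Definition gauss_tail (x : R) : R :=
  \int[mu]_(t in `[x, +oo[) gauss_density t.

Definition t0 : R := Num.sqrt (2 * ln 2).

Definition constA : R :=
  \int[mu]_(t in `[0, +oo[) Num.min 1 (2 * expR (- (t ^+ 2 / 2))).

Definition constB : R := constA / 2.

Definition funH (x : R) : R :=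
  2 * x * expR (- (x ^+ 2 / 2))
  + 2 * \int[mu]_(t in `[x, +oo[) expR (- (t ^+ 2 / 2)).

(* [xget 0 S] picks an element of S when S is nonempty; here and for [zpoint]
   the set S is a singleton. *)
Definition abar : R := xget 0 [set x | t0 < x /\ funH x = constB].

Definition p0 : R := 2 * expR (- (abar ^+ 2 / 2)).

Definition zpoint : R := xget 0 [set x | gauss_tail x = p0].

Definition c0 : R := constB / gauss_density zpoint.

End Constant.

(* Main.v *)
From HB Require Import structures.
Require Import Defs.
From mathcomp Require Import measurable_realfun zify ring lra.

(* Every ridge reduces to one dimension: it suffices to compare [(<v, X> - s)^+]
   and [(c0 <v, G> - s)^+] in expectation for unit [v] and [s >= 0], because a
   convex function of one variable is a limit of affine functions plus
   nonnegative combinations of such hinges.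

   For a centred [Y] with subgaussian tails, [s |-> E (Y - s)^+] is convex, is at
   most [B] at [0] (half of [E |Y| <= A]), and is at most
   [2 \int_s^oo exp (-t^2/2) dt] everywhere.  Hence on [[0, abar]] it lies below
   the chord [B - p0 s], which by the choice of [abar] is tangent to the second
   bound, and beyond [abar] it lies below that bound.  The constant [c0] is the
   one for which the same line is tangent to [s |-> E (c0 g - s)^+], so it lies
   below this convex function.  Beyond [abar] the difference
   [E (c0 g - s)^+ - 2 \int_s^oo exp (-t^2/2) dt] starts nonnegative, tends to
   [0], and once it decreases it keeps decreasing, by Mills' inequality. *)

(** The constants come from two tangent lines. The tangent to [2 \int_s^oo exp (-t^2/2) dt] at
    [s = x] has slope [-2 exp (-x^2/2)] and height [funH x] at [s = 0], so [funH abar = B] selects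
    the tangent through [(0, B)], and [p0] is minus its slope. The curve [s |-> E (c g - s)^+] has
    slope [-p0] exactly at [s = c z], and its tangent there has height [c] times the normal density
    of [z] at [s = 0]; equating this height with [B] gives [c0].

    Mills' inequality is strong enough beyond [abar] only because [1 + (s / c0)^2 <= s^2] there;
    this is where numerical bounds on [pi] and [ln 2] enter.

    Negative thresholds reduce to positive ones by passing from [v] to [-v]. Expectations of convex
    functions may be infinite, so they are compared after subtracting an affine minorant with the
    same finite mean under both laws, which leaves nonnegative integrands. Independence of the
    coordinates of [G] is given on rectangles only, so the law of [<v, G>] is built up one
    coordinate at a time. *)

Set Implicit Arguments.
Unset Strict Implicit.
Unset Printing Implicit Defensive.

Import Order.TTheory GRing.Theory Num.Theory.
Import numFieldNormedType.Exports.

Local Open Scope classical_set_scope.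
Local Open Scope ring_scope.

(** * The Gaussian tail integral *)

Section GaussianTail.
Context {R : realType}.
Local Notation mu := (@lebesgue_measure R).
Implicit Types x y s t : R.

Lemma is_derive_continuous (f : R -> R) x l : is_derive x 1 f l ->
  {for x, continuous f}.
Proof. by move=> [df _]; exact/differentiable_continuous/derivable1_diffP. Qed.

Lemma is_derive_ge0_le (f df : R -> R) x y : x <= y ->
  (forall s, is_derive s 1 f (df s)) ->
  (forall s, x <= s <= y -> 0 <= df s) -> f x <= f y.
Proof.
move=> xy fdf df0; rewrite -subr_ge0.
have [|s sxy ->] := MVT_segment xy (fun s _ => fdf s).
  by apply: continuous_subspaceT => s; exact: is_derive_continuous (fdf s).
by rewrite mulr_ge0 ?subr_ge0//; apply: df0; rewrite in_itv/= in sxy.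
Qed.

(** [constA], [funH] and [p0] are built from the bare exponential, so the density and its tail are
    kept unnormalised; the factor [gnorm] is added only on the Gaussian side. *)
Definition gexp x : R := expR (- (x ^+ 2 / 2)).

Definition gnorm : R := (Num.sqrt (2 * pi))^-1.

Definition gupper x : R := \int[mu]_(t in `[x, +oo[) gexp t.

Lemma gexp_gt0 x : 0 < gexp x. Proof. exact: expR_gt0. Qed.
Lemma gexp_ge0 x : 0 <= gexp x. Proof. exact: expR_ge0. Qed.

Lemma gexp_le1 x : gexp x <= 1.
Proof. by rewrite /gexp expR_le1 oppr_le0 divr_ge0// sqr_ge0. Qed.

Lemma gnorm_gt0 : 0 < gnorm.
Proof. by rewrite invr_gt0 sqrtr_gt0 mulr_gt0 ?pi_gt0. Qed.

Lemma gauss_density_gexp x : gauss_density x = gnorm * gexp x.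
Proof. exact: gauss_densityE. Qed.

#[global] Instance is_derive_gexp x : is_derive x 1 gexp (- x * gexp x).
Proof.
rewrite /gexp; apply: is_derive_eq.
by rewrite /GRing.scale/=; field.
Qed.

Lemma continuous_gexp : continuous gexp.
Proof. by move=> x; exact: is_derive_continuous (is_derive_gexp x). Qed.

Lemma gexpE x : gexp x = gnorm^-1 * normal_pdf 0 1 x.
Proof.
by rewrite -[normal_pdf 0 1 x]/(gauss_density x) gauss_density_gexp mulKf// gt_eqF// gnorm_gt0.
Qed.

Lemma integrable_gexp (D : set R) : measurable D -> mu.-integrable D (EFin \o gexp).
Proof.
move=> mD; apply: (@integrableS _ _ _ mu setT) => //.
rewrite (_ : _ \o _ = fun x => gnorm^-1%:E * (normal_pdf 0 1 x)%:E)%E; last first.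
  by apply/funext => x; rewrite /= gexpE EFinM.
by apply: integrableZl => //; exact: integrable_normal_pdf.
Qed.

Lemma measurable_gexp (D : set R) : measurable_fun D gexp.
Proof. by apply: measurable_funTS; exact: continuous_measurable_fun continuous_gexp. Qed.

Lemma gupper_ge0 x : 0 <= gupper x.
Proof. by apply: Rintegral_ge0 => t _; exact: gexp_ge0. Qed.

Lemma EFin_gupper x : (\int[mu]_(t in `[x, +oo[) (gexp t)%:E)%E = (gupper x)%:E.
Proof.
rewrite /gupper /Rintegral fineK//.
by have /integrable_fin_num := @integrable_gexp `[x, +oo[ (measurable_itv _); exact.
Qed.

Lemma gauss_tailE x : gauss_tail x = gnorm * gupper x.
Proof.
rewrite /gauss_tail /gupper -RintegralZl//; last exact: integrable_gexp.
by apply: eq_Rintegral => t _; rewrite gauss_density_gexp.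
Qed.

(** The fundamental theorem of calculus differentiates in the upper limit, so the tail is turned
    into the total mass minus an integral over a lower ray. *)
Lemma gupper_complement x :
  gupper x = \int[mu]_t gexp t - \int[mu]_(t in `]-oo, x]) gexp t.
Proof.
have := @Rintegral_itvB R gexp -oo%O +oo%O x.
rewrite set_itvNyy => ->//; last exact: integrable_gexp.
by rewrite Rintegral_itv_obnd_cbnd//; exact: integrable_gexp.
Qed.

#[global] Instance is_derive_gupper x : is_derive x 1 gupper (- gexp x).
Proof.
have [||||d1 d2] := @continuous_FTC1 R gexp -oo%O x (x + 1).
- by rewrite ltrDl.
- exact: integrable_gexp.
- exact: ltNyr.
- exact: continuous_gexp.
rewrite (_ : gupper = (fun x => \int[mu]_t gexp t - \int[mu]_(t in `]-oo, x]) gexp t)); last first.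
  by apply/funext => y; exact: gupper_complement.
pose F y := \int[mu]_(t in `]-oo, y]) gexp t.
have dF : is_derive x 1 F (gexp x).
  by apply: DeriveDef; [exact: d1|rewrite -derive1E; exact: d2].
by rewrite -/F -[- gexp x]sub0r; apply: is_deriveB.
Qed.

Lemma continuous_gupper : continuous gupper.
Proof. by move=> x; exact: is_derive_continuous (is_derive_gupper x). Qed.

(** The identity as a random variable under [N(0, 1)]: its [ccdf] is the normalised tail, so the
    general limits of [ccdf] at both infinities apply to [gupper]. *)
Let real_id : measurableTypeR R -> R := fun x => x.

#[local] HB.instance Definition _ :=
  isMeasurableFun.Build _ _ _ _ real_id (@measurable_id _ _ setT).

Lemma ccdf_normal x :
  ccdf (real_id : {RV normal_prob (0 : R) 1 >-> R}) x = (gnorm * gupper x)%:E.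
Proof.
rewrite (_ : ccdf _ x = \int[mu]_(t in `]x, +oo[) (normal_pdf 0 1 t)%:E)%E//.
rewrite integral_itv_obnd_cbnd; last first.
  by apply/measurable_EFinP; apply: measurable_funTS; exact: measurable_normal_pdf.
under eq_integral do rewrite -[normal_pdf _ _ _]/(gauss_density _) gauss_density_gexp EFinM.
rewrite integralZl//=; last exact: integrable_gexp.
by rewrite EFin_gupper.
Qed.

Lemma cvg_gupper_y : gupper x @[x --> +oo] --> (0 : R).
Proof.
have := @cvg_ccdfy0 _ _ R (normal_prob 0 1) (real_id : {RV normal_prob (0 : R) 1 >-> R}).
rewrite (_ : ccdf _ = fun x => (gnorm * gupper x)%:E); last first.
  by apply/funext => x; exact: ccdf_normal.
move=> /fine_cvgP[_] /= cv.
rewrite (_ : gupper = fun x => gnorm^-1 * (gnorm * gupper x)); last first.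
  by apply/funext => x; rewrite mulKf// gt_eqF// gnorm_gt0.
rewrite -(mulr0 gnorm^-1); apply: cvgM; first exact: cvg_cst.
exact: cv.
Qed.

Lemma cvg_gupper_Ny : gnorm * gupper x @[x --> -oo] --> (1 : R).
Proof.
have := @cvg_ccdfNy1 _ _ R (normal_prob 0 1) (real_id : {RV normal_prob (0 : R) 1 >-> R}).
rewrite (_ : ccdf _ = fun x => (gnorm * gupper x)%:E); last first.
  by apply/funext => x; exact: ccdf_normal.
by move=> /fine_cvgP[_].
Qed.

(** From [expR u >= 1 + u] at [u = x^2 / 2]. Quadratic decay is also enough for [x * gexp x] to
    vanish at infinity. *)
Lemma gexp_le_inv x : 0 < x -> gexp x <= 2 / x ^+ 2.
Proof.
move=> x0; rewrite /gexp expRN -[2 / _]invf_div.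
have x20 : 0 < x ^+ 2 / 2 by rewrite divr_gt0 ?exprn_gt0.
rewrite lef_pV2 ?posrE ?expR_gt0//.
by apply: le_trans (expR_ge1Dx _); rewrite lerDr.
Qed.

Lemma cvg_inv_y : (x^-1 : R) @[x --> +oo] --> (0 : R).
Proof.
apply/cvgrPdist_le => /= e e0; near=> x.
have x0 : 0 < x by near: x; exact: nbhs_pinfty_gt.
rewrite sub0r normrN ger0_norm ?invr_ge0 ?(ltW x0)//.
rewrite -[leRHS]invrK lef_pV2 ?posrE ?invr_gt0//.
Unshelve. all: by end_near. Qed.

Lemma cvg_gexp_y : gexp x @[x --> +oo] --> (0 : R).
Proof.
apply: (@squeeze_cvgr _ _ _ _ (cst 0) (fun x => 2 * (x^-1 * x^-1))).
- near=> x; have x0 : 0 < x by near: x; exact: nbhs_pinfty_gt.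
  by rewrite gexp_ge0 (le_trans (gexp_le_inv x0))// expr2 invfM.
- exact: cvg_cst.
- rewrite -[X in _ --> X](mulr0 2); apply: cvgM; first exact: cvg_cst.
  by rewrite -[X in _ --> X](mulr0 0); apply: cvgM; exact: cvg_inv_y.
Unshelve. all: by end_near. Qed.

Lemma cvg_Mgexp_y : x * gexp x @[x --> +oo] --> (0 : R).
Proof.
apply: (@squeeze_cvgr _ _ _ _ (cst 0) (fun x => 2 * x^-1)).
- near=> x; have x0 : 0 < x by near: x; exact: nbhs_pinfty_gt.
  rewrite mulr_ge0 ?gexp_ge0 ?(ltW x0)//=.
  rewrite (le_trans (ler_wpM2l (ltW x0) (gexp_le_inv x0)))//.
  by rewrite expr2 invfM mulrCA mulrA mulrA -(mulrA 2) divff ?gt_eqF// mulr1.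
- exact: cvg_cst.
- rewrite -[X in _ --> X](mulr0 2); apply: cvgM; first exact: cvg_cst.
  exact: cvg_inv_y.
Unshelve. all: by end_near. Qed.

(** [- gexp t / t] is an antiderivative of [(1 + t^-2) * gexp t], so [gexp x / x] is the integral of
    the latter over [[x, +oo[]. Bounding [t^-2] by [x^-2] and multiplying by [x^2] gives the
    claim. *)
Lemma mills x : 0 < x -> x * gexp x <= (1 + x ^+ 2) * gupper x.
Proof.
move=> x0.
pose f t := (1 + (t^-1) ^+ 2) * gexp t.
pose F t := - (t^-1 * gexp t).
have dF t : 0 < t -> is_derive t 1 F (f t).
  move=> t0; rewrite /F /f; have tn0 : t != 0 by rewrite gt_eqF.
  have dV := @is_deriveV R id t 1 1 tn0 (is_derive_id _ _).
  have dM := is_deriveN (is_deriveM dV (is_derive_gexp t)).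
  apply: (is_derive_eq dM).
  by rewrite /GRing.scale/=; field.
have cf t : 0 < t -> {for t, continuous f}.
  move=> t0; apply: cvgM; last exact: continuous_gexp.
  apply: cvgD; first exact: cvg_cst.
  by apply: cvgM; apply: cvgV; rewrite ?gt_eqF//; exact: cvg_id.
have f0 t : x <= t -> 0 <= f t.
  by move=> _; rewrite mulr_ge0 ?gexp_ge0// addr_ge0 ?sqr_ge0.
have cwf : {within `[x, +oo[, continuous f}.
  apply/continuous_within_itvcyP; split.
    by move=> t; rewrite in_itv/= andbT => xt; apply: cf; exact: lt_trans xt.
  exact/cvg_at_right_filter/cf.
have F0 : F t @[t --> +oo] --> 0.
  rewrite -oppr0; apply: cvgN; rewrite -(mulr0 0).
  by apply: cvgM; [exact: cvg_inv_y|exact: cvg_gexp_y].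
have dF' t : x < t -> is_derive t 1 F (f t) by move=> /(lt_trans x0)/dF.
have Fx : F t @[t --> x^'+] --> F x.
  by apply: cvg_at_right_filter; exact: is_derive_continuous (dF _ x0).
have FE : {in `]x, +oo[, (F^`())%classic =1 f}.
  move=> t; rewrite in_itv/= andbT => xt.
  by rewrite derive1E; have [_ ->] := dF' _ xt.
have := @ge0_continuous_FTC2y R f F x 0 f0 cwf F0
  (fun t xt => @ex_derive _ _ _ _ _ _ _ (dF' t xt)) Fx FE.
rewrite sub0e -EFinN /F opprK => E.
have le1 : ((x^-1 * gexp x)%:E <= ((1 + (x^-1) ^+ 2) * gupper x)%:E)%E.
  rewrite -E EFinM -EFin_gupper -ge0_integralZl//=; last 3 first.
  - by apply/measurable_EFinP; exact: measurable_gexp.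
  - by move=> t _; rewrite lee_fin gexp_ge0.
  - by rewrite lee_fin addr_ge0 ?sqr_ge0.
  apply: ge0_le_integral => //=.
  - by move=> t; rewrite in_itv/= andbT => xt; rewrite lee_fin f0.
  - apply/measurable_EFinP; apply: subspace_continuous_measurable_fun => //.
  - apply: measurable_funeM; by apply/measurable_EFinP; exact: measurable_gexp.
  - move=> t; rewrite in_itv/= andbT => xt.
    rewrite -EFinM lee_fin ler_wpM2r ?gexp_ge0// lerD2l.
    rewrite ler_sqr ?nnegrE ?invr_ge0 ?(ltW x0) ?(le_trans (ltW x0) xt)//.
    by rewrite lef_pV2 ?posrE// (lt_le_trans x0 xt).
rewrite lee_fin in le1.
have x20 : 0 <= x ^+ 2 by rewrite sqr_ge0.
have := ler_wpM2l x20 le1.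
have xn0 : x != 0 by rewrite gt_eqF.
rewrite (_ : x ^+ 2 * (x^-1 * gexp x) = x * gexp x); last by field.
by rewrite (_ : x ^+ 2 * _ = (1 + x ^+ 2) * gupper x)//; field.
Qed.

End GaussianTail.

(** * The constants of the theorem *)

Section Constants.
Context {R : realType}.
Local Notation mu := (@lebesgue_measure R).
Implicit Types x y s t : R.

Lemma sin_le_id x : 0 <= x -> sin x <= x.
Proof.
move=> x0.
have d t : is_derive t 1 (id - sin : R -> R) (1 - cos t) by apply: is_deriveB.
have := is_derive_ge0_le x0 d; rewrite !fctE sin0 subr0 subr_ge0; apply.
by move=> t _; rewrite subr_ge0 cos_le1.
Qed.

(** This is [sin a <= a] at [a = pi / 6], once [sin a = 1 / 2] is known. *)
Lemma pi_ge3 : 3 <= pi :> R.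
Proof.
pose a : R := pi / 6; have pi0 : 0 < pi :> R := pi_gt0 R.
have s0 : 0 < sin a by apply: sin_gt0_pihalf; rewrite /a; lra.
have s3 : 3 * sin a - 4 * sin a ^+ 3 = 1.
  transitivity (sin (pi / 2) : R); last exact: sin_pihalf.
  rewrite (_ : pi / 2 = a + a + a); last by rewrite /a; field.
  have c2 : cos a * cos a = 1 - sin a * sin a.
    by have := cos2Dsin2 a; rewrite !expr2; lra.
  rewrite !sinD cosD [RHS](_ : _ = 3 * sin a * (cos a * cos a) - sin a ^+ 3); last by ring.
  by rewrite c2; ring.
have sE : sin a = 2^-1.
  (* The triple-angle equation [3 x - 4 x^3 = 1] factors this way, and [sin a > 0] rules out the
     root [-1]. *)
  have /eqP : (sin a + 1) * (2 * sin a - 1) ^+ 2 = 0.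
    have : 0 = 1 - (3 * sin a - 4 * sin a ^+ 3) by rewrite s3 subrr.
    by move=> ->; ring.
  rewrite mulf_eq0 expf_eq0/= => /orP[/eqP|/eqP]; lra.
by have := @sin_le_id a; rewrite sE /a => /(_ ltac:(lra)); lra.
Qed.

Lemma ln2_ge : 2 / 3 <= ln 2 :> R.
Proof.
rewrite -ler_expR lnK ?posrE//.
rewrite -[expR _]invrK -expRN -[leRHS]invrK lef_pV2 ?posrE ?invr_gt0 ?expR_gt0//.
(* Applied once, [1 + x <= expR x] gives only [1 / 3]; split into ten factors it gives
   [(14 / 15)^10], which exceeds [1 / 2]. *)
rewrite (_ : - (2 / 3) = 10%:R * - (1 / 15)); last by field.
rewrite expRM_natl.
apply: (@le_trans _ _ ((1 - 1 / 15) ^+ 10)); first by lra.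
by rewrite lerXn2r ?nnegrE ?expR_ge0 ?(le_trans _ (expR_ge1Dx _))//; lra.
Qed.

Lemma ler_gexp x y : 0 <= x -> x <= y -> gexp y <= gexp x.
Proof.
move=> x0 xy; rewrite ler_expR lerN2 ler_pM2r ?invr_gt0//.
by rewrite ler_sqr ?nnegrE ?(le_trans x0).
Qed.

Lemma ltr_gexp x y : 0 <= x -> x < y -> gexp y < gexp x.
Proof.
move=> x0 xy; rewrite ltr_expR ltrN2 ltr_pM2r ?invr_gt0//.
by rewrite ltr_sqr ?nnegrE ?(le_trans x0 (ltW xy)).
Qed.

Lemma sqr_t0 : t0 R ^+ 2 = 2 * ln 2.
Proof. by rewrite sqr_sqrtr// mulr_ge0// ln_ge0// ler1n. Qed.

Lemma t0_gt0 : 0 < t0 R.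
Proof. by rewrite sqrtr_gt0 mulr_gt0// ln_gt0// ltr1n. Qed.

Lemma gexp_t0 : gexp (t0 R) = 2^-1.
Proof. by rewrite /gexp sqr_t0 mulrAC divff// mul1r expRN lnK ?posrE. Qed.

Lemma integrable_min_gexp :
  mu.-integrable `[0, +oo[ (EFin \o (fun t => Num.min 1 (2 * gexp t))).
Proof.
apply: (@le_integrable _ _ _ mu _ (measurable_itv _) _ (fun t => 2%:E * (gexp t)%:E)%E).
- apply/measurable_EFinP; apply: measurable_minr => //.
  by apply: measurable_funM => //; exact: measurable_gexp.
- move=> t _; rewrite -EFinM lee_fin !ger0_norm ?mulr_ge0 ?gexp_ge0//.
    by rewrite ge_min lexx orbT.
  by rewrite le_min ler01 mulr_ge0 ?gexp_ge0.
- by apply: integrableZl => //; exact: integrable_gexp.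
Qed.

(** The two arguments of the minimum cross at [t0], where [gexp] equals [1 / 2]. *)
Lemma constAE : constA R = t0 R + 2 * gupper (t0 R).
Proof.
pose m t := Num.min 1 (2 * gexp t).
have m1 t : 0 <= t <= t0 R -> m t = 1.
  move=> /andP[t_ge0 tt0]; apply/min_idPl.
  by have := ler_gexp t_ge0 tt0; rewrite gexp_t0; lra.
have m2 t : t0 R <= t -> m t = 2 * gexp t.
  move=> tt0; apply/min_idPr.
  by have := ler_gexp (ltW t0_gt0) tt0; rewrite gexp_t0; lra.
have := @Rintegral_itvB R m (BLeft 0) +oo%O (t0 R) integrable_min_gexp.
rewrite bnd_simp (ltW t0_gt0) => /(_ isT isT) /eqP.
rewrite subr_eq -/(constA R) => /eqP ->; rewrite addrC; congr (_ + _).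
  rewrite (@eq_Rintegral _ _ _ _ _ (cst 1)).
    rewrite Rintegral_cst// mul1r [X in fine X](@lebesgue_measure_itv R `[0, t0 R]).
    by rewrite /= lte_fin t0_gt0 /= subr0.
  by move=> t; rewrite inE/= in_itv/= => /m1.
transitivity (\int[mu]_(t in `]t0 R, +oo[) (2 * gexp t)).
  by apply: eq_Rintegral => t; rewrite inE/= in_itv/= andbT => /ltW /m2.
rewrite RintegralZl//; last exact: integrable_gexp.
by rewrite Rintegral_itv_obnd_cbnd//; exact: integrable_gexp.
Qed.

(* Only crude numerics are needed: this bound with [2 / 3 <= ln 2] and [3 <= pi]
   already gives [sqr_c0_t0]. *)
Lemma constA_lb : t0 R * (1 + (1 + t0 R ^+ 2)^-1) <= constA R.
Proof.
have p : 0 < 1 + t0 R ^+ 2 by rewrite ltr_pwDl ?sqr_ge0.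
rewrite constAE mulrDr mulr1 lerD2l ler_pdivrMr//.
by have := mills t0_gt0; rewrite gexp_t0; lra.
Qed.

Lemma constB_gt0 : 0 < constB R.
Proof.
rewrite divr_gt0// (lt_le_trans _ constA_lb)// mulr_gt0 ?t0_gt0//.
by rewrite ltr_pwDl// invr_ge0 addr_ge0// sqr_ge0.
Qed.

(** [xget] returns a solution as soon as one exists. One does by the intermediate value theorem:
    [funH] equals [constA > constB] at [t0] and tends to [0]. *)
Lemma abarP : t0 R < abar R /\
  2 * abar R * gexp (abar R) + 2 * gupper (abar R) = constB R.
Proof.
rewrite /abar; apply: (@xgetPex _ 0 [set x | t0 R < x /\ funH x = constB R]) => /=.
pose H x := 2 * (x * gexp x) + 2 * gupper x.
have HE x : funH x = H x by rewrite /H mulrA.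
have HA : H (t0 R) = constA R by rewrite /H gexp_t0 constAE mulrCA divff// mulr1.
have cH : H x @[x --> +oo] --> (0 : R).
  have c1 : 2 * (x * gexp x) @[x --> +oo] --> (2 * 0 : R).
    by apply: cvgM; [exact: cvg_cst|exact: cvg_Mgexp_y].
  have c2 : 2 * gupper x @[x --> +oo] --> (2 * 0 : R).
    by apply: cvgM; [exact: cvg_cst|exact: cvg_gupper_y].
  by rewrite !mulr0 in c1 c2; rewrite -[X in _ --> X](addr0 (0 : R)); exact: (cvgD c1 c2).
have [M [t0M HM]] : exists M, t0 R < M /\ H M <= constB R.
  have [M [_ hM]] : \forall x \near +oo, t0 R < x /\ H x <= constB R.
    near=> x; split; first by near: x; by apply: nbhs_pinfty_gt; rewrite num_real.
    by near: x; apply: (cvgr_le _ cH); exact: constB_gt0.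
  (* A neighbourhood of [+oo] gives the bounds only strictly beyond [M]. *)
  by exists (M + 1); apply: hM; rewrite ltrDl.
have cont : {within `[t0 R, M], continuous H}.
  apply: continuous_subspaceT => x.
  apply: cvgD; apply: cvgM; [exact: cvg_cst| |exact: cvg_cst|exact: continuous_gupper].
  by apply: cvgM; [exact: cvg_id|exact: continuous_gexp].
have AB : constB R < constA R by have := constB_gt0; rewrite /constB; lra.
have [|c] := IVT (v := constB R) (ltW t0M) cont.
  by rewrite ge_min HM orbT le_max HA (ltW AB).
rewrite in_itv/= => /andP[t0c cM] Hc; exists c; rewrite HE; split => //.
rewrite lt_neqAle t0c andbT; apply/eqP => t0E.
by move: AB; rewrite -HA t0E Hc ltxx.
Unshelve. all: by end_near. Qed.

Lemma abar_gt0 : 0 < abar R.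
Proof. exact: lt_trans t0_gt0 abarP.1. Qed.

Lemma p0_gt0 : 0 < p0 R. Proof. by rewrite mulr_gt0 ?expR_gt0. Qed.

Lemma p0_lt1 : p0 R < 1.
Proof.
have := ltr_gexp (ltW t0_gt0) abarP.1.
by rewrite gexp_t0 /p0 -/(gexp (abar R)); lra.
Qed.

(** Again by intermediate values: [p0] lies strictly between the limits [1] and [0] of the Gaussian
    tail. *)
Lemma zpointP : gnorm * gupper (zpoint R) = p0 R.
Proof.
rewrite -gauss_tailE.
rewrite /zpoint; apply: (@xgetPex _ 0 [set x | gauss_tail x = p0 R]) => /=.
pose F x := gnorm * gupper x : R.
have FE x : gauss_tail x = F x by rewrite gauss_tailE.
have [a Fa] : exists a, p0 R <= F a.
  have [M [_ hM]] : \forall x \near -oo, p0 R <= F x.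
    by apply: (cvgr_ge _ cvg_gupper_Ny); exact: p0_lt1.
  by exists (M - 1); apply: hM; rewrite gtrBl.
have [b [ab Fb]] : exists b, a < b /\ F b <= p0 R.
  have cF : F x @[x --> +oo] --> (0 : R).
    rewrite -(mulr0 gnorm); apply: cvgM; [exact: cvg_cst|exact: cvg_gupper_y].
  have [M [_ hM]] : \forall x \near +oo, a < x /\ F x <= p0 R.
    near=> x; split; first by near: x; by apply: nbhs_pinfty_gt; rewrite num_real.
    by near: x; apply: (cvgr_le _ cF); exact: p0_gt0.
  by exists (M + 1); apply: hM; rewrite ltrDl.
have cont : {within `[a, b], continuous F}.
  apply: continuous_subspaceT => x.
  by apply: cvgM; [exact: cvg_cst|exact: continuous_gupper].
have [|c _ Fc] := IVT (v := p0 R) (ltW ab) cont.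
  by rewrite ge_min Fb orbT le_max Fa.
by exists c; rewrite FE.
Unshelve. all: by end_near. Qed.

Lemma c0_gt0 : 0 < c0 R.
Proof.
rewrite /c0 gauss_density_gexp divr_gt0 ?constB_gt0//.
by rewrite mulr_gt0 ?gnorm_gt0 ?gexp_gt0.
Qed.

Lemma c0M : c0 R * (gnorm * gexp (zpoint R)) = constB R.
Proof.
by rewrite /c0 gauss_density_gexp divfK// mulf_neq0// gt_eqF// ?gnorm_gt0 ?gexp_gt0.
Qed.

(** The normal density is at most [(2 pi)^(-1/2)], so [c0^2 >= 2 pi B^2], and [pi >= 3]. *)
Lemma c0_lb : 6 * constB R ^+ 2 <= c0 R ^+ 2.
Proof.
have B0 := constB_gt0; have k0 := @gnorm_gt0 R.
have k2 : gnorm ^+ 2 = (2 * pi)^-1 :> R.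
  by rewrite exprVn sqr_sqrtr// mulr_ge0// pi_ge0.
apply: (@le_trans _ _ (c0 R ^+ 2 * (6 * gnorm ^+ 2))).
  rewrite -c0M.
  rewrite (_ : 6 * _ ^+ 2 = (c0 R ^+ 2 * (6 * gnorm ^+ 2)) * gexp (zpoint R) ^+ 2); last by ring.
  apply: ler_piMr; first by rewrite mulr_ge0 ?sqr_ge0// mulr_ge0 ?sqr_ge0.
  by rewrite expr_le1 ?gexp_ge0 ?gexp_le1.
apply: ler_piMr; first exact: sqr_ge0.
rewrite k2 ler_pdivrMr ?mulr_gt0 ?pi_gt0// mul1r.
by have := pi_ge3; lra.
Qed.

(** Equivalent to [1 + (t0 / c0)^2 <= t0^2], the starting case of [sqr_c0_abar]. With
    [L = t0^2 = 2 ln 2], the bounds [c0^2 >= 6 B^2] and [2 B (1 + L) >= t0 (L + 2)] reduce it to a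
    polynomial inequality in [L >= 4 / 3]. *)
Lemma sqr_c0_t0 : t0 R ^+ 2 <= c0 R ^+ 2 * (t0 R ^+ 2 - 1).
Proof.
have lb := c0_lb; have lbA := constA_lb; have t00 := t0_gt0.
have ln2 := ln2_ge; have L2 := sqr_t0.
set L := t0 R ^+ 2 in lbA L2 *.
have L43 : 4 / 3 <= L by lra.
have L10 : 0 < 1 + L by lra.
apply: (@le_trans _ _ (6 * constB R ^+ 2 * (L - 1))); last first.
  by rewrite ler_wpM2r//; lra.
have lbB : t0 R * (L + 2) <= 2 * constB R * (1 + L).
  have -> : 2 * constB R = constA R by rewrite /constB mulrCA divff// mulr1.
  rewrite -ler_pdivrMr//; apply: le_trans lbA.
  by rewrite le_eqVlt; apply/orP; left; apply/eqP; field; lra.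
have sq : L * (L + 2) ^+ 2 <= 4 * constB R ^+ 2 * (1 + L) ^+ 2.
  have h : (t0 R * (L + 2)) ^+ 2 <= (2 * constB R * (1 + L)) ^+ 2.
    have p1 : 0 <= t0 R * (L + 2) by apply: mulr_ge0; [exact: ltW|lra].
    by rewrite ler_sqr ?nnegrE// (le_trans p1).
  move: h; rewrite !exprMn -/L; lra.
have L12 : 0 < 4 * (1 + L) ^+ 2 by rewrite mulr_gt0// exprn_gt0.
rewrite -(ler_pM2r L12).
have h6 : 0 <= 6 * (L - 1) by lra.
have := ler_wpM2l h6 sq.
(* Without the common factor [L], this reads [196 / 9 <= 200 / 9] at [L = 4 / 3]: the numerical
   bounds leave little slack. *)
have : L * (4 * (1 + L) ^+ 2) <= 6 * (L - 1) * (L * (L + 2) ^+ 2).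
  rewrite (_ : 6 * _ * _ = L * (6 * (L - 1) * (L + 2) ^+ 2)); last by ring.
  rewrite ler_wpM2l//; first by lra.
  by nra.
lra.
Qed.

(* With [y = s / c0], this is what turns Mills' inequality at [y] into
   [hazard_le_abar]. *)
Lemma sqr_c0_abar s : abar R <= s -> 1 + (s / c0 R) ^+ 2 <= s ^+ 2.
Proof.
move=> as_; have c00 := c0_gt0; have := sqr_c0_t0.
have : t0 R ^+ 2 <= s ^+ 2.
  rewrite ler_sqr ?nnegrE ?(ltW t0_gt0) ?(le_trans (ltW t0_gt0))//.
    exact: le_trans (ltW abarP.1) as_.
  exact: le_trans (ltW abarP.1) as_.
have c2 : 0 < c0 R ^+ 2 by rewrite exprn_gt0.
(* The goal amounts to [c0^2 <= s^2 (c0^2 - 1)]; with [c0^2 >= 1] the right-hand side grows with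
   [s^2], so the case of [t0] suffices. *)
have c21 : 1 <= c0 R ^+ 2.
  have := ln2_ge; have := sqr_t0; have := sqr_c0_t0; nra.
move=> h1 h2; rewrite -(ler_pM2r c2) mulrDl mul1r (expr_div_n s) divfK ?gt_eqF//.
by nra.
Qed.

End Constants.

(** * Stop-loss transform of a centred Gaussian *)

Section StopLoss.
Context {R : realType}.
Local Notation mu := (@lebesgue_measure R).
Implicit Types c x y s t : R.

(** Closed form of [E (c g - s)^+] for a standard normal [g] and [c > 0]. *)
Definition stoploss c s := c * (gnorm * gexp (s / c)) - s * (gnorm * gupper (s / c)).

Lemma integral_stoploss c s : 0 < c ->
  (\int[mu]_(t in `[(s / c)%R, +oo[) ((c * t - s) * (gnorm * gexp t))%R%:E = (stoploss c s)%:E)%E.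
Proof.
move=> c0.
pose f t := (c * t - s) * (gnorm * gexp t).
pose F t := - (c * (gnorm * gexp t) - s * (gnorm * gupper t)).
have dF t : is_derive t 1 F (f t).
  rewrite /F /f; apply: is_derive_eq.
  by rewrite /GRing.scale/=; ring.
have cf : continuous f.
  move=> t; apply: cvgM; last first.
    by apply: cvgM; [exact: cvg_cst|exact: continuous_gexp].
  apply: cvgB; last exact: cvg_cst.
  by apply: cvgM; [exact: cvg_cst|exact: cvg_id].
have f0 t : s / c <= t -> 0 <= f t.
  rewrite ler_pdivrMr// => sct; rewrite mulr_ge0// ?mulr_ge0 ?gexp_ge0 ?(ltW gnorm_gt0)//.
  by rewrite subr_ge0 mulrC.
have F0 : F t @[t --> +oo] --> (0 : R).
  rewrite -oppr0; apply: cvgN; rewrite -(subr0 (0 : R)).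
  have g0 (h : R -> R) r : h t @[t --> +oo] --> (0 : R) -> r * (gnorm * h t) @[t --> +oo] --> (0 : R).
    move=> h0; rewrite -(mulr0 r); apply: cvgM; first exact: cvg_cst.
    by rewrite -(mulr0 gnorm); apply: cvgM; [exact: cvg_cst|].
  by apply: cvgB; apply: g0; [exact: cvg_gexp_y|exact: cvg_gupper_y].
have Fx : F t @[t --> (s / c)^'+] --> F (s / c).
  by apply: cvg_at_right_filter; exact: is_derive_continuous (dF _).
have FE : {in `](s / c), +oo[, (F^`())%classic =1 f}.
  by move=> t _; rewrite derive1E; have [_ ->] := dF t.
have := @ge0_continuous_FTC2y R f F (s / c) 0 f0 (continuous_subspaceT cf) F0
  (fun t _ => @ex_derive _ _ _ _ _ _ _ (dF t)) Fx FE.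
by rewrite sub0e -EFinN /F opprK.
Qed.

Lemma stoploss_ge0 c s : 0 < c -> 0 <= stoploss c s.
Proof.
move=> c0; rewrite -lee_fin -integral_stoploss// integral_ge0// => t /=.
rewrite in_itv/= andbT ler_pdivrMr// => sct.
by rewrite lee_fin mulr_ge0// ?subr_ge0 1?mulrC ?mulr_ge0 ?gexp_ge0 ?(ltW gnorm_gt0).
Qed.

(* As a function of [s], the left-hand side is the tangent line of [stoploss c] at
   [c * y]; for fixed [s] it is maximal at [y = s / c]. *)
Lemma stoploss_tangent c y s : 0 < c ->
  c * (gnorm * gexp y) - s * (gnorm * gupper y) <= stoploss c s.
Proof.
move=> c0; have k0 := @gnorm_gt0 R.
pose q x := c * (gnorm * gexp x) - s * (gnorm * gupper x).
have dq x : is_derive x 1 q ((s - c * x) * (gnorm * gexp x)).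
  rewrite /q; apply: is_derive_eq.
  by rewrite /GRing.scale/=; ring.
have kg x : 0 <= gnorm * gexp x by rewrite mulr_ge0 ?gexp_ge0 ?ltW.
rewrite -/(q y) /stoploss -/(q (s / c)).
have [ys|/ltW sy] := leP y (s / c).
  apply: (is_derive_ge0_le ys dq) => x /andP[_ xs].
  by rewrite mulr_ge0// subr_ge0 mulrC -ler_pdivlMr.
rewrite -lerN2; have dNq x := is_deriveN (dq x).
apply: (is_derive_ge0_le sy dNq) => x /andP[xs _].
by rewrite oppr_ge0 mulr_le0_ge0// subr_le0 mulrC -ler_pdivrMr.
Qed.

(** The left-hand side is the tangent of [stoploss c0] at [c0 * z]: its slope is [-p0] by [zpointP]
    and its height at [0] is [constB] by [c0M]. *)
Lemma constB_le_stoploss s : constB R - p0 R * s <= stoploss (c0 R) s.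
Proof. by rewrite -c0M -zpointP [_ * s]mulrC; apply: stoploss_tangent; exact: c0_gt0. Qed.

Lemma is_derive_gupper_div c s : c != 0 ->
  is_derive s 1 (fun s => gupper (s / c)) (- gexp (s / c) / c).
Proof.
move=> c0; have dl : is_derive s 1 (fun t => t / c) c^-1.
  by apply: is_derive_eq; rewrite /GRing.scale/=; ring.
exact: (@is_derive1_comp R gupper (fun t => t / c) s _ _ (is_derive_gupper (s / c)) dl).
Qed.

Lemma is_derive_stoploss c s : c != 0 ->
  is_derive s 1 (stoploss c) (- (gnorm * gupper (s / c))).
Proof.
move=> c0; have h2 := is_derive_gupper_div s c0.
have dl : is_derive s 1 (fun t => t / c) c^-1.
  by apply: is_derive_eq; rewrite /GRing.scale/=; ring.
have h1 : is_derive s 1 (fun s => gexp (s / c)) (- (s / c) * gexp (s / c) * c^-1).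
  exact: (@is_derive1_comp R gexp (fun t => t / c) s _ _ (is_derive_gexp (s / c)) dl).
rewrite /stoploss; apply: is_derive_eq.
by rewrite /GRing.scale/=; field.
Qed.

Local Notation c0 := (c0 R).
Local Notation abar := (abar R).

(** Mills' inequality at [s / c0], with [1 + (s / c0)^2] replaced by the larger [s^2] and a factor
    [s] cancelled. It is the sign condition on the derivative of [E] in [gupper_le_stoploss]. *)
Lemma hazard_le_abar s : abar <= s -> gexp (s / c0) / c0 <= s * gupper (s / c0).
Proof.
move=> as_; have s0 : 0 < s := lt_le_trans abar_gt0 as_.
have y0 : 0 < s / c0 by rewrite divr_gt0// c0_gt0.
have := mills y0; have := ler_wpM2r (gupper_ge0 (s / c0)) (sqr_c0_abar as_).
move=> h1 h2; have := le_trans h2 h1.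
by rewrite expr2 -!mulrA ler_pM2l// mulrC.
Qed.

(** By contradiction: [D abar >= 0 > D s] yields [r] between them with [D' r < 0]. Then [D' <= 0]
    from [r] on, so [D] stays below [D s < 0], whereas [D >= - 2 * gupper] and the tail tends to
    [0]. *)
Lemma gupper_le_stoploss s : abar <= s -> 2 * gupper s <= stoploss c0 s.
Proof.
move=> as_; have k0 := @gnorm_gt0 R.
have c0n0 : c0 != 0 by rewrite gt_eqF// c0_gt0.
pose D t := stoploss c0 t - 2 * gupper t.
pose D' t := 2 * gexp t - gnorm * gupper (t / c0).
have dD t : is_derive t 1 D (D' t).
  have := is_derive_stoploss t c0n0 => dS.
  rewrite /D /D'; apply: is_derive_eq.
  by rewrite /GRing.scale/=; ring.
(* [D' <= 0] iff [2 <= E], and [E] is nondecreasing on [[abar, +oo[]. *)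
pose E t := gnorm * gupper (t / c0) * expR (t ^+ 2 / 2).
have D'E t : D' t = gexp t * (2 - E t).
  rewrite /D' /E /gexp mulrBr; congr (_ - _); first by rewrite mulrC.
  by rewrite mulrCA -mulrA -expRD addNr expR0 mulr1.
have dE t : is_derive t 1 E
    (gnorm * expR (t ^+ 2 / 2) * (t * gupper (t / c0) - gexp (t / c0) / c0)).
  have h2 := is_derive_gupper_div t c0n0.
  rewrite /E; apply: is_derive_eq.
  by rewrite /GRing.scale/=; field; rewrite gt_eqF// c0_gt0.
(* By [abarP] the line [constB - p0 * s] has height [2 * gupper abar] at [s = abar]. *)
have Da : 0 <= D abar.
  have := constB_le_stoploss abar; have [_ <-] := abarP (R := R).
  rewrite /D /p0 -/(gexp abar) => h; rewrite subr_ge0; apply: le_trans h.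
  lra.
rewrite -subr_ge0 -/(D s) leNgt; apply/negP => Ds.
have as1 : abar < s.
  by rewrite lt_neqAle as_ andbT; apply/eqP => e; move: Ds; rewrite -e ltNge Da.
have [|r] := MVT as1 (fun t _ => dD t).
  by apply: continuous_subspaceT => t; exact: is_derive_continuous (dD t).
rewrite in_itv/= => /andP[ar rs] rE.
have D'r : D' r < 0.
  have sa : 0 < s - abar by rewrite subr_gt0.
  by rewrite -(pmulr_llt0 _ sa) -rE; lra.
have E2 : 2 <= E r.
  by move: D'r; rewrite D'E pmulr_rlt0 ?gexp_gt0// subr_lt0 => /ltW.
have D'le0 t : r <= t -> D' t <= 0.
  move=> rt; rewrite D'E pmulr_rle0 ?gexp_gt0// subr_le0 (le_trans E2)//.
  apply: (is_derive_ge0_le rt dE) => u /andP[ru _].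
  rewrite mulr_ge0 ?mulr_ge0 ?expR_ge0 ?(ltW k0)// subr_ge0 hazard_le_abar//.
  exact: le_trans (ltW ar) ru.
have Dle t : s <= t -> D t <= D s.
  move=> st; rewrite -lerN2; have dND x := is_deriveN (dD x).
  apply: (is_derive_ge0_le st dND) => u /andP[su _].
  by rewrite oppr_ge0 D'le0// (le_trans (ltW rs)).
(* Any such [t] has [D t >= - 2 * gupper t >= D s / 2 > D s]. *)
have [M [_ hM]] : \forall t \near +oo, gupper t <= - D s / 4.
  by apply: (cvgr_le _ cvg_gupper_y); lra.
have := hM (Num.max (M + 1) s); rewrite lt_max ltrDl ltr01 => /(_ isT) hm.
have := Dle (Num.max (M + 1) s); rewrite le_max lexx orbT => /(_ isT).
rewrite {1}/D; have := @stoploss_ge0 c0 (Num.max (M + 1) s) c0_gt0; lra.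
Qed.

End StopLoss.

(** * Stop-loss bounds for subgaussian variables *)

Section Hinge.
Context {R : realType}.
Implicit Types x y : R.

Definition hinge x := Num.max x 0.

Lemma hinge_ge0 x : 0 <= hinge x. Proof. by rewrite le_max lexx orbT. Qed.

Lemma ger0_hinge x : 0 <= x -> hinge x = x. Proof. exact: max_l. Qed.

Lemma ler0_hinge x : x <= 0 -> hinge x = 0. Proof. exact: max_r. Qed.

Lemma le_hinge x : x <= hinge x. Proof. by rewrite le_max lexx. Qed.

Lemma hinge_le_norm x : hinge x <= `|x|.
Proof. by rewrite ge_max ler_norm normr_ge0. Qed.

Lemma hingeN x : hinge (- x) = hinge x - x.
Proof.
have [x0|/ltW x0] := leP 0 x.
  by rewrite (ger0_hinge x0) subrr ler0_hinge// oppr_le0.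
by rewrite (ler0_hinge x0) sub0r ger0_hinge// oppr_ge0.
Qed.

Lemma hingeM a x : 0 <= a -> hinge (a * x) = a * hinge x.
Proof. by move=> a0; rewrite /hinge maxr_pMr// mulr0. Qed.

Lemma hinge_convex th x y : 0 <= th <= 1 ->
  hinge (th * x + (1 - th) * y) <= th * hinge x + (1 - th) * hinge y.
Proof.
move=> /andP[th0 th1]; have th1' : 0 <= 1 - th by rewrite subr_ge0.
rewrite {1}/hinge ge_max; apply/andP; split.
  by rewrite lerD// ler_wpM2l// le_hinge.
by rewrite addr_ge0// mulr_ge0// hinge_ge0.
Qed.

Lemma measurable_hinge : measurable_fun [set: R] hinge.
Proof. exact: measurable_maxr. Qed.

End Hinge.

(** * Integrability on a probability space and the layer-cake formula *)

Section RintegralProbability.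
Context {d : measure_display} {T : measurableType d} {R : realType}.
Variable P : probability T R.

Lemma EFin_Rintegral (f : T -> R) : P.-integrable setT (EFin \o f) ->
  (\int[P]_w (f w)%:E = (\int[P]_w f w)%R%:E)%E.
Proof. by move=> fi; rewrite /Rintegral fineK//; exact: integrable_fin_num fi. Qed.

Lemma integrable_cstP (r : R) : P.-integrable setT (EFin \o cst r).
Proof. exact: finite_measure_integrable_cst. Qed.

Lemma integrable_hinge (f : T -> R) : P.-integrable setT (EFin \o f) ->
  P.-integrable setT (EFin \o (fun w => hinge (f w))).
Proof.
move=> fi; have mf := measurable_int P fi; apply: le_integrable fi => //.
  apply/measurable_EFinP; apply: measurableT_comp; first exact: measurable_hinge.
  exact/measurable_EFinP.
by move=> w _ /=; rewrite lee_fin ger0_norm ?hinge_ge0// hinge_le_norm.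
Qed.

Lemma integrable_EFinZ (f : T -> R) a : P.-integrable setT (EFin \o f) ->
  P.-integrable setT (EFin \o (fun w => a * f w)).
Proof. by move=> fi; exact: (integrableZl measurableT a fi). Qed.

Lemma integrable_EFinD (f g : T -> R) : P.-integrable setT (EFin \o f) ->
  P.-integrable setT (EFin \o g) ->
  P.-integrable setT (EFin \o (fun w => f w + g w)).
Proof. by move=> fi gi; exact: (integrableD measurableT fi gi). Qed.

Lemma integrable_affine (f : T -> R) a b : P.-integrable setT (EFin \o f) ->
  P.-integrable setT (EFin \o (fun w => a * f w + b)).
Proof.
move=> fi; apply: integrable_EFinD; last exact: integrable_cstP.
exact: integrable_EFinZ.
Qed.

Lemma Rintegral_affine (f : T -> R) a b : P.-integrable setT (EFin \o f) ->
  \int[P]_w (a * f w + b) = a * \int[P]_w f w + b.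
Proof.
move=> fi; rewrite RintegralD//; last exact: integrable_cstP.
  rewrite RintegralZl//; congr (_ + _).
  by rewrite Rintegral_cst// [X in fine X](probability_setT P) mulr1.
exact: integrable_EFinZ.
Qed.

Lemma measurable_set_gt (Z : T -> R) (t : R) : measurable_fun setT Z ->
  measurable [set w | t < Z w].
Proof.
move=> mZ; rewrite (_ : [set w | _] = setT `&` Z @^-1` `]t, +oo[).
  by apply: mZ => //; exact: measurable_itv.
by rewrite setTI; apply/seteqP; split => w /=; rewrite in_itv/= andbT.
Qed.

(** Layer-cake formula. Measurability of the tail is stated with it because every use bounds or
    computes the integral of that tail. *)
Lemma ge0_integral_tail (Z : T -> R) : measurable_fun setT Z ->
  (forall w, 0 <= Z w) ->
  (\int[P]_w (Z w)%:E =
   \int[lebesgue_measure]_(t in `[0%R, +oo[) P [set w | (t < Z w)%R])%E /\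
  measurable_fun [set: measurableTypeR R] (fun t => P [set w | (t < Z w)%R]).
Proof.
move=> mZ Z0.
pose Z' : {RV P >-> R} := HB.pack Z (isMeasurableFun.Build _ _ _ _ Z mZ).
have ccdfE : ccdf Z' = (fun t => P [set w | (t < Z w)%R]).
  apply/funext => t; rewrite /ccdf /distribution; congr (P _).
  by apply/seteqP; split => w /=; rewrite in_itv/= andbT.
split; last by rewrite -ccdfE; exact: ccdf_measurable.
by rewrite -ccdfE -ge0_expectation_ccdf// expectation_def.
Qed.

End RintegralProbability.

Section SubgaussianStopLoss.
Context {d : measure_display} {T : measurableType d} {R : realType}.
Variables (P : probability T R) (Y : T -> R).
Hypothesis iY : P.-integrable setT (EFin \o Y).
Hypothesis Y0 : \int[P]_w Y w = 0.
Hypothesis Ytail : forall t : R, 0 <= t ->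
  (P [set w | (t < `|Y w|)%R] <= (2 * gexp t)%:E)%E.

Let mY : measurable_fun setT Y.
Proof. by apply/measurable_EFinP; exact: (measurable_int P). Qed.

Let iNY : P.-integrable setT (EFin \o (fun w => `|Y w|)).
Proof. exact: integrable_norm. Qed.

(** [constA] is what the layer-cake formula yields when the tail is bounded by the smaller of [1]
    and the subgaussian bound. *)
Lemma Rintegral_norm_le_constA : \int[P]_w `|Y w| <= constA R.
Proof.
have mN : measurable_fun setT (fun w => `|Y w|) by exact: measurableT_comp.
rewrite -lee_fin -EFin_Rintegral//.
have [-> mP] := ge0_integral_tail P mN (fun w => normr_ge0 _).
rewrite /constA /Rintegral fineK; last first.
  by apply: integrable_fin_num; [|exact: integrable_min_gexp].
apply: ge0_le_integral => //.
- exact: measurable_funTS mP.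
- by apply: (measurable_int lebesgue_measure); exact: integrable_min_gexp.
- move=> t; rewrite /= in_itv/= andbT => t0.
  rewrite EFin_min le_min -/(gexp t) Ytail// andbT.
  by apply: probability_le1; exact: measurable_set_gt.
Qed.

Lemma Rintegral_hinge_le_constB : \int[P]_w hinge (Y w) <= constB R.
Proof.
(* The trailing [+ 0] gives the shape expected by [Rintegral_affine]. *)
have E w : hinge (Y w) = 2^-1 * (`|Y w| + Y w) + 0.
  have [y0|/ltW y0] := leP 0 (Y w).
    by rewrite ger0_hinge// ger0_norm//; field.
  by rewrite ler0_hinge// ler0_norm// addNr mulr0 addr0.
rewrite (eq_Rintegral P (fun w _ => E w)) Rintegral_affine ?addr0; last first.
  exact: integrable_EFinD.
rewrite RintegralD// Y0 addr0 /constB [leRHS]mulrC ler_pM2l ?invr_gt0//.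
exact: Rintegral_norm_le_constA.
Qed.

(** Layer cake again: for [t >= 0] the event [t < hinge (Y - s)] lies in [s + t < |Y|], and the
    bound [2 * gexp (s + t)] integrates to [2 * gupper s]. *)
Lemma Rintegral_hinge_le_gupper (s : R) : 0 <= s ->
  \int[P]_w hinge (Y w - s) <= 2 * gupper s.
Proof.
move=> s0.
have iYs : P.-integrable setT (EFin \o (fun w => Y w - s)).
  by have := integrable_affine 1 (- s) iY; under eq_fun do rewrite mul1r.
have iH := integrable_hinge iYs.
have mH : measurable_fun setT (fun w => hinge (Y w - s)).
  by apply/measurable_EFinP; exact: (measurable_int P).
rewrite -lee_fin -EFin_Rintegral//.
have [-> mP] := ge0_integral_tail P mH (fun w => hinge_ge0 _).
have dS (t : R) : is_derive t 1 (fun t => - (2 * gupper (s + t))) (2 * gexp (s + t)).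
  have dl : is_derive t 1 (fun t : R => s + t) 1.
    rewrite -[X in is_derive _ _ _ X](add0r (1 : R)); apply: is_deriveD.
  have h : is_derive t 1 (fun t => gupper (s + t)) (- gexp (s + t) * 1).
    exact: (@is_derive1_comp R gupper (fun t : R => s + t) t _ _ (is_derive_gupper (s + t)) dl).
  apply: is_derive_eq.
  by rewrite /GRing.scale/=; ring.
have cg : continuous (fun t : R => 2 * gexp (s + t)).
  move=> t; apply: cvgM; first exact: cvg_cst.
  apply: continuous_comp; last exact: continuous_gexp.
  by apply: cvgD; [exact: cvg_cst|exact: cvg_id].
have E : (\int[lebesgue_measure]_(t in `[0%R, +oo[) (2 * gexp (s + t))%:E = (2 * gupper s)%:E)%E.
  rewrite (@ge0_continuous_FTC2y R (fun t => 2 * gexp (s + t)) (fun t => - (2 * gupper (s + t))) 0 0).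
  - by rewrite addr0 sub0e -EFinN opprK.
  - by move=> t _; rewrite mulr_ge0 ?gexp_ge0.
  - exact: continuous_subspaceT.
  - rewrite -oppr0; apply: cvgN; rewrite -(mulr0 2); apply: cvgM; first exact: cvg_cst.
    apply: cvg_comp cvg_gupper_y; exact: cvg_addrl.
  - by move=> t _; have [] := dS t.
  - by apply: cvg_at_right_filter; exact: is_derive_continuous (dS 0).
  - by move=> t _; rewrite derive1E; have [_ ->] := dS t.
rewrite -E; apply: ge0_le_integral => //.
- exact: measurable_funTS mP.
- by apply/measurable_EFinP; apply: measurable_funTS; exact: continuous_measurable_fun.
- move=> t; rewrite /= in_itv/= andbT => t0.
  apply: le_trans (Ytail (addr_ge0 s0 t0)).
  apply: le_measure; rewrite ?inE.
  + exact: measurable_set_gt.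
  + by apply: measurable_set_gt; exact: measurableT_comp.
  + move=> w /=; rewrite /hinge lt_max [t < 0]ltNge t0/= orbF ltrBrDl => h.
    exact: lt_le_trans h (ler_norm _).
Qed.

Lemma Rintegral_hinge_le_stoploss (s : R) : 0 <= s ->
  \int[P]_w hinge (Y w - s) <= stoploss (c0 R) s.
Proof.
move=> s0; have a0 := @abar_gt0 R.
have [as_|/ltW sa] := leP (abar R) s.
  exact: le_trans (Rintegral_hinge_le_gupper s0) (gupper_le_stoploss as_).
apply: le_trans (constB_le_stoploss s).
have iYs r : P.-integrable setT (EFin \o (fun w => hinge (Y w - r))).
  apply: integrable_hinge.
  by have := integrable_affine 1 (- r) iY; under eq_fun do rewrite mul1r.
(* The weight of [0] when [s] is written as a convex combination of [0] and [abar]. *)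
pose th := 1 - s / abar R.
have th01 : 0 <= th <= 1.
  rewrite /th subr_ge0 ler_pdivrMr// mul1r sa/= gerBl divr_ge0//.
  exact: ltW.
have le1 w : hinge (Y w - s) <= (1 - th) * hinge (Y w - abar R) + th * hinge (Y w).
  have -> : Y w - s = th * Y w + (1 - th) * (Y w - abar R).
    by rewrite /th; field; rewrite gt_eqF.
  by rewrite [leRHS]addrC; apply: hinge_convex.
have iYa := iYs (abar R); have iY0 := integrable_hinge iY.
have i1 : P.-integrable setT (EFin \o (fun w => (1 - th) * hinge (Y w - abar R))).
  exact: integrable_EFinZ.
have i2 : P.-integrable setT (EFin \o (fun w => th * hinge (Y w))).
  exact: integrable_EFinZ.
apply: (@le_trans _ _ (\int[P]_w ((1 - th) * hinge (Y w - abar R) + th * hinge (Y w)))).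
  by apply: le_Rintegral => //; exact: integrable_EFinD.
rewrite RintegralD// !RintegralZl//.
have h1 := Rintegral_hinge_le_gupper (ltW a0).
have h2 := Rintegral_hinge_le_constB.
move/andP : th01 => [th0 th1].
have th1' : 0 <= 1 - th by rewrite subr_ge0.
apply: le_trans (lerD (ler_wpM2l th1' h1) (ler_wpM2l th0 h2)) _.
have [_ <-] := abarP (R := R).
rewrite /p0 -/(gexp (abar R)) le_eqVlt; apply/orP; left; apply/eqP.
by rewrite /th; field; rewrite gt_eqF.
Qed.

End SubgaussianStopLoss.

(** * Rotation invariance of the Gaussian law *)

Section GaussianRotation.
Context {R : realType}.
Local Notation mu := (@lebesgue_measure R).
Local Notation N := (normal_prob (0 : R) 1).
Implicit Types (a b m x y t : R) (B : set (measurableTypeR R)).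

(** Open upper rays are closed under intersection, generate the Borel sets and exhaust the line. *)
Lemma measure_ray_unique (m1 m2 : {measure set (measurableTypeR R) -> \bar R}) :
  (m1 setT < +oo)%E ->
  (forall x, m1 `]x, +oo[%classic = m2 `]x, +oo[%classic) ->
  forall B, measurable B -> m1 B = m2 B.
Proof.
move=> m1oo m12 B mB.
apply: (@measure_unique _ R (measurableTypeR R) (@RGenOInfty.G R)
  (fun k => (`]- k%:R, +oo[%classic : set R)) _ _ _ _ m1 m2 _ _ B mB).
- exact: RGenOInfty.measurableE.
- move=> _ _ [x ->] [y ->]; exists (Num.max x y).
  by apply/seteqP; split => z; rewrite /= !in_itv/= !andbT gt_max => /andP.
- by move=> k; exists (- k%:R).
- apply/seteqP; split => // x _.
  have [k hk] : exists k : nat, - x < k%:R.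
    by exists (Num.trunc `|x|).+1; rewrite (le_lt_trans (ler_norm _))// normrN truncnS_gt.
  by exists k => //=; rewrite in_itv/= andbT ltrNl.
- by move=> _ [x ->]; exact: m12.
- by move=> k; apply: le_lt_trans m1oo; apply: le_measure; rewrite ?inE.
Qed.

(** The scale will be a coefficient of a linear form and may be negative, hence the absolute
    value. *)
Lemma normal_pdf_gexp m b x : b != 0 ->
  normal_pdf m b x = gnorm / `|b| * gexp ((x - m) / b).
Proof.
move=> b0; rewrite normal_pdfE// /normal_peak /normal_fun /gexp; congr (_ * expR _).
  rewrite /gnorm -mulrnAr sqrtrM ?sqr_ge0// sqrtr_sqr -mulr_natl invfM mulrC.
  by rewrite mulr_natl.
by rewrite expr_div_n -mulr_natr; field.
Qed.

Lemma gaussian_ray x : N `]x, +oo[%classic = (gnorm * gupper x)%:E.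
Proof. exact: ccdf_normal. Qed.

Lemma gaussian_closed_ray x : N `[x, +oo[%classic = (gnorm * gupper x)%:E.
Proof.
rewrite -gaussian_ray /normal_prob integral_itv_obnd_cbnd//.
by apply/measurable_EFinP; apply: measurable_funTS; exact: measurable_normal_pdf.
Qed.

Lemma gaussian_lower_ray x : N `]-oo, x[%classic = (1 - gnorm * gupper x)%:E.
Proof.
by rewrite -setCitvr probability_setC// [X in (1 - X)%E](gaussian_closed_ray x).
Qed.

Lemma is_derive_gupper_affine m b x : b != 0 ->
  is_derive x 1 (fun x => gnorm * gupper ((x - m) / b)) (- (gnorm * gexp ((x - m) / b) / b)).
Proof.
move=> b0.
have dl : is_derive x 1 (fun x => (x - m) / b) b^-1.
  apply: is_derive_eq; by rewrite /GRing.scale/=; ring.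
have h : is_derive x 1 (fun x => gupper ((x - m) / b)) (- gexp ((x - m) / b) * b^-1).
  exact: (@is_derive1_comp R gupper (fun x => (x - m) / b) x _ _ (is_derive_gupper _) dl).
by apply: is_derive_eq; rewrite /GRing.scale/=; ring.
Qed.

(** The limit [l] is [0] for [b > 0] and [1] for [b < 0]; the sign of [b] merges the two cases. *)
Lemma normal_prob_ray m b t l : b != 0 ->
  gnorm * gupper ((x - m) / b) @[x --> +oo] --> l ->
  normal_prob m b `]t, +oo[%classic =
    (Num.sg b * (gnorm * gupper ((t - m) / b) - l))%:E.
Proof.
move=> b0 cl.
rewrite /normal_prob integral_itv_obnd_cbnd; last first.
  by apply/measurable_EFinP; apply: measurable_funTS; exact: measurable_normal_pdf.
pose F x := - Num.sg b * (gnorm * gupper ((x - m) / b)).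
have dF x : is_derive x 1 F (normal_pdf m b x).
  have := is_derive_gupper_affine m x b0 => dg.
  rewrite /F; apply: is_derive_eq; rewrite /GRing.scale/= normal_pdf_gexp//.
  have -> : `|b|^-1 = Num.sg b / b.
    have /orP[bn|bp] : (b < 0) || (0 < b) by rewrite -neq_lt.
      by rewrite ltr0_norm// ltr0_sg// invrN mulN1r.
    by rewrite gtr0_norm// gtr0_sg// mul1r.
  by ring.
rewrite (@ge0_continuous_FTC2y R (normal_pdf m b) F t (- Num.sg b * l)).
- by rewrite -EFinB /F; congr EFin; ring.
- by move=> x _; exact: normal_pdf_ge0.
- by apply: continuous_subspaceT; exact: continuous_normal_pdf.
- by apply: cvgM; [exact: cvg_cst|].
- by move=> x _; have [] := dF x.
- by apply: cvg_at_right_filter; exact: is_derive_continuous (dF t).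
- by move=> x _; rewrite derive1E; have [_ ->] := dF x.
Qed.

(** Named so that it carries a measurable-function structure and [distribution N (affine m b)] is a
    measure. *)
Definition affine m b : measurableTypeR R -> measurableTypeR R :=
  fun x => m + b * x.

Lemma measurable_affine m b : measurable_fun [set: measurableTypeR R] (affine m b).
Proof. by apply: measurable_funD => //; exact: measurable_funM. Qed.

HB.instance Definition _ m b :=
  isMeasurableFun.Build _ _ (measurableTypeR R) (measurableTypeR R)
    (affine m b) (measurable_affine m b).

Lemma gaussian_affine m b B : b != 0 -> measurable B ->
  N (affine m b @^-1` B) = normal_prob m b B.
Proof.
move=> b0 mB.
have uniq := @measure_ray_unique (distribution N (affine m b)) (normal_prob m b).
apply: (uniq _ _ B mB).
  by apply: (le_lt_trans (probability_le1 _ _)); rewrite ?ltry.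
move=> t; rewrite /distribution /pushforward/=.
have /orP[bn|bp] : (b < 0) || (0 < b) by rewrite -neq_lt.
- rewrite [RHS](@normal_prob_ray m b t 1)//.
    rewrite (_ : _ @^-1` _ = `]-oo, (t - m) / b[%classic).
      by rewrite gaussian_lower_ray ltr0_sg//; congr EFin; ring.
    apply/seteqP; split => x /=; rewrite !in_itv/= ?andbT /affine => h.
      by rewrite ltr_ndivlMr// mulrC ltrBlDl.
    by move: h; rewrite ltr_ndivlMr// mulrC ltrBlDl.
  apply: cvg_comp cvg_gupper_Ny; apply/cvgrNyPle => A; near=> x.
  by rewrite ler_ndivrMr// lerBrDr; near: x; apply: nbhs_pinfty_ge; rewrite num_real.
- rewrite [RHS](@normal_prob_ray m b t 0)//.
    rewrite (_ : _ @^-1` _ = `](t - m) / b, +oo[%classic).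
      by rewrite gaussian_ray gtr0_sg// subr0 mul1r.
    apply/seteqP; split => x /=; rewrite !in_itv/= !andbT /affine => h.
      by rewrite ltr_pdivrMr// mulrC ltrBlDl.
    by move: h; rewrite ltr_pdivrMr// mulrC ltrBlDl.
  rewrite -(mulr0 gnorm); apply: cvgM; first exact: cvg_cst.
  apply: cvg_comp cvg_gupper_y; apply: gt0_cvgMly; first by rewrite invr_gt0.
  exact: cvg_addrr.
Unshelve. all: by end_near. Qed.

(** Radon-Nikodym change of variables: the derivative with respect to Lebesgue measure is almost
    everywhere the density. The bound by [1] makes [f] integrable. *)
Lemma integral_gaussian (f : measurableTypeR R -> \bar R) : measurable_fun setT f ->
  (forall y, 0 <= f y <= 1)%E ->
  (\int[N]_y f y = \int[mu]_y (f y * (normal_pdf 0 1 y)%:E))%E.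
Proof.
move=> mf f01; have dom := normal_prob_dominates (0 : R) 1.
rewrite -(Radon_Nikodym_change_of_variables dom)//=; last first.
  apply/integrableP; split => //.
  have le1 : (\int[N]_y `|f y| <= \int[N]_y (cst (1 : \bar R) y))%E.
    apply: ge0_le_integral => //=; first exact: measurableT_comp.
    by move=> y _; have /andP[f0 f1] := f01 y; rewrite gee0_abs.
  apply: (le_lt_trans le1); rewrite integral_cst// mul1e.
  by apply: (le_lt_trans (probability_le1 _ _)); rewrite ?ltry.
apply: ae_eq_integral => //.
- exact: emeasurable_funM.
- by apply: emeasurable_funM => //; apply/measurable_EFinP; exact: measurable_normal_pdf.
- apply: ae_eqe_mul2l => /=.
  rewrite Radon_NikodymE//=.
  case: cid => /= h [h1 h2 h3].
  apply: integral_ae_eq => //=.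
    by apply/measurable_EFinP; exact: measurable_normal_pdf.
  by move=> E _ mE; rewrite -h3.
Qed.

(* Completing the square in [y]. *)
Lemma normal_pdf_mulC a b y w : b != 0 -> let tau := Num.sqrt (a ^+ 2 + b ^+ 2) in
  normal_pdf (a * y) b w * normal_pdf 0 1 y =
  normal_pdf 0 tau w * normal_pdf (a * w / tau ^+ 2) (b / tau) y.
Proof.
move=> b0 tau.
have tau2 : tau ^+ 2 = a ^+ 2 + b ^+ 2 by rewrite sqr_sqrtr// addr_ge0// sqr_ge0.
have tau0 : 0 < tau by rewrite sqrtr_gt0 ltr_wpDl ?sqr_ge0// exprn_even_gt0.
have tn0 : tau != 0 by rewrite gt_eqF.
rewrite !normal_pdf_gexp ?oner_neq0 ?mulf_neq0 ?invr_eq0//.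
rewrite normr1 !divr1 !subr0 normrM normfV (gtr0_norm tau0).
have nb0 : `|b| != 0 by rewrite normr_eq0.
rewrite [LHS](_ : _ = gnorm ^+ 2 / `|b| * (gexp ((w - a * y) / b) * gexp y)); last by ring.
rewrite [RHS](_ : _ = gnorm ^+ 2 / `|b| *
    (gexp (w / tau) * gexp ((y - a * w / tau ^+ 2) / (b / tau)))); last first.
  by field; rewrite tn0 nb0.
congr (_ * _); rewrite /gexp -!expRD; congr expR.
rewrite (_ : ((y - a * w / tau ^+ 2) / (b / tau)) ^+ 2 =
    (y - a * w / tau ^+ 2) ^+ 2 * tau ^+ 2 / b ^+ 2); last first.
  by field; rewrite tn0 b0.
rewrite (_ : (w / tau) ^+ 2 = w ^+ 2 / tau ^+ 2); last by rewrite expr_div_n.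
rewrite tau2; by field; rewrite b0 -tau2 expf_neq0.
Qed.

Lemma measurable_shear b B : measurable B ->
  measurable [set z : measurableTypeR R * measurableTypeR R | B (z.1 + b * z.2)].
Proof.
move=> mB; rewrite -[X in measurable X]setTI.
have m : measurable_fun setT (fun z : measurableTypeR R * measurableTypeR R => z.1 + b * z.2).
  by apply: measurable_funD => //; exact: measurable_funM.
exact: m.
Qed.

Lemma measurable_gaussian_section a b B : measurable B ->
  measurable_fun setT (fun y : measurableTypeR R => N (affine (a * y) b @^-1` B)).
Proof.
move=> mB.
have mD := measurable_shear b mB.
have h := measurable_fun_xsection N mD.
rewrite (_ : (fun _ => _) = (N \o xsection
    [set z : measurableTypeR R * measurableTypeR R | B (z.1 + b * z.2)]) \o (fun y => a * y)).
  by apply: measurableT_comp => //; exact: measurable_funM.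
apply/funext => y /=; congr (normal_prob _ _ _).
by apply/seteqP; split => x; rewrite /xsection /= ?inE.
Qed.

(** For independent standard normals, [a g + b g'] has the law of [sqrt (a^2 + b^2) g]. After
    Tonelli and [normal_pdf_mulC] the inner integral over [y] is that of a normal density, hence
    [1]. *)
Lemma gaussian_rotation a b B : 0 <= a -> measurable B ->
  (\int[N]_y N (affine (a * y) b @^-1` B) =
   N (affine 0 (Num.sqrt (a ^+ 2 + b ^+ 2)) @^-1` B))%E.
Proof.
move=> a0 mB.
(* For [b = 0] the inner law is a Dirac mass, which has no density. *)
have [->|b0] := eqVneq b 0.
  rewrite expr0n addr0 sqrtr_sqr ger0_norm//.
  rewrite -[RHS]mul1e -integral_cst; last first.
    by rewrite -[X in measurable X]setTI; exact: measurable_affine.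
  rewrite [RHS]integral_mkcond; apply: eq_integral => y _.
  rewrite patchE; case: ifPn; rewrite ?inE ?notin_setE /= /affine add0r => By.
    rewrite (_ : _ @^-1` _ = setT) ?probability_setT//.
    by apply/seteqP; split => // x _ /=; rewrite mul0r addr0.
  rewrite (_ : _ @^-1` _ = set0) ?measure0//.
  by apply/seteqP; split => // x /=; rewrite mul0r addr0.
pose tau := Num.sqrt (a ^+ 2 + b ^+ 2).
have tau0 : tau != 0 by rewrite gt_eqF// sqrtr_gt0 ltr_wpDl ?sqr_ge0// exprn_even_gt0.
rewrite gaussian_affine//.
pose K y w := normal_pdf (a * y) b w * normal_pdf 0 1 y.
have mpdf m s := @measurable_normal_pdf R m s.
have mKB : measurable_fun setT
    (fun z : measurableTypeR R * measurableTypeR R => (K z.1 z.2 * \1_B z.2)%:E).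
  apply/measurable_EFinP; apply: measurable_funM; last first.
    by apply: measurableT_comp => //; exact: measurable_indic.
  apply: measurable_funM; last exact: (measurableT_comp (mpdf 0 1) measurable_fst).
  rewrite (_ : (fun _ => _) = fun z => gnorm / `|b| * gexp ((z.2 - a * z.1) / b)); last first.
    by apply/funext => z; rewrite normal_pdf_gexp.
  apply: measurable_funM => //; apply: measurableT_comp; first exact: measurable_gexp.
  apply: measurable_funM => //; apply: measurable_funB => //.
  by apply: measurable_funM.
have K0 y w : 0 <= K y w by rewrite mulr_ge0 ?normal_pdf_ge0.
under eq_integral do rewrite gaussian_affine//.
rewrite integral_gaussian; last 2 first.
- by under eq_fun do rewrite -gaussian_affine//; exact: measurable_gaussian_section.
- by move=> y; rewrite measure_ge0 probability_le1.
transitivity (\int[mu]_y \int[mu]_w (K y w * \1_B w)%:E)%E.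
  apply: eq_integral => y _.
  rewrite /normal_prob -ge0_integralZr//=; last 3 first.
  - by apply/measurable_EFinP; apply: measurable_funTS; exact: mpdf.
  - by move=> w _; rewrite lee_fin normal_pdf_ge0.
  - by rewrite lee_fin normal_pdf_ge0.
  rewrite integral_mkcond; apply: eq_integral => w _.
  by rewrite patchE indicE; case: ifPn; rewrite ?mulr1 ?mulr0// -EFinM.
rewrite (@fubini_tonelli _ _ _ _ _ mu mu (fun z => (K z.1 z.2 * \1_B z.2)%:E) mKB)/=; last first.
  by move=> z; rewrite lee_fin mulr_ge0.
rewrite /normal_prob [RHS]integral_mkcond; apply: eq_integral => w _.
rewrite patchE indicE; case: ifPn => wB; last first.
  by apply: integral0_eq => y _; rewrite mulr0.
under eq_integral do rewrite mulr1 /K normal_pdf_mulC// EFinM.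
rewrite ge0_integralZl//=; last 3 first.
- by apply/measurable_EFinP; exact: mpdf.
- by move=> y _; rewrite lee_fin normal_pdf_ge0.
- by rewrite lee_fin normal_pdf_ge0.
by rewrite integral_normal_pdf mule1.
Qed.

End GaussianRotation.

(** * The law of a linear form in a standard Gaussian vector *)

Section GaussianLaw.
Context {R : realType} {dS : measure_display} {S : measurableType dS}.
Variable Q : probability S R.
Local Notation N := (normal_prob (0 : R) 1).

(** [E] stands for the constraints on coordinates not yet summed, and [e] for its probability. The
    rectangle formula identifies the law of [(U, V)] restricted to [E] with a product measure, to
    which [gaussian_rotation] applies. *)
Lemma joint_gaussian_rotation (U V : S -> measurableTypeR R) (E : set S)
    (e : {nonneg R}) (a : R) :
  measurable_fun setT U -> measurable_fun setT V -> measurable E -> 0 <= a ->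
  (forall B C, measurable B -> measurable C ->
    Q ([set w | B (U w) /\ C (V w)] `&` E) =
      (e%:num%:E * N (affine 0 a @^-1` B) * N C)%E) ->
  forall (b : R) B, measurable B ->
  Q ([set w | B (U w + b * V w)] `&` E) =
    (e%:num%:E * N (affine 0 (Num.sqrt (a ^+ 2 + b ^+ 2)) @^-1` B))%E.
Proof.
move=> mU mV mE a0 rect b B mB.
have mUV : measurable_fun setT (fun w => (U w, V w)) by exact: measurable_fun_pair.
pose UV : {mfun S >-> (measurableTypeR R * measurableTypeR R)%type} :=
  HB.pack (fun w => (U w, V w)) (isMeasurableFun.Build _ _ _ _ (fun w => (U w, V w)) mUV).
pose m1 := mscale e (distribution N (affine 0 a)).
pose m' := pushforward (mrestr Q mE) UV.
pose D := [set z : measurableTypeR R * measurableTypeR R | B (z.1 + b * z.2)].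
have mD : measurable D := measurable_shear b mB.
have m'E C : m' C = Q ([set w | C (U w, V w)] `&` E) by [].
have uniq : (m1 \x N)%E D = m' D by exact: product_measure_unique.
rewrite -[LHS]/(m' D) -uniq.
have mND := measurable_fun_xsection N mD.
transitivity (\int[m1]_x (N \o xsection D) x)%E; first by [].
rewrite ge0_integral_mscale//; congr (_ * _)%E.
rewrite ge0_integral_distribution//.
rewrite -gaussian_rotation//; apply: eq_integral => y _ /=.
congr (normal_prob _ _ _); apply/seteqP; split => x; rewrite /xsection /= ?inE /D /affine /= add0r//.
Qed.

Variable d : nat.
Variable G : {RV Q >-> d.-tuple R}.
Hypothesis gG : standard_gaussian Q G.
Variable w : d.-tuple R.

Let gi (i : 'I_d) : S -> measurableTypeR R := fun s => tnth (G s) i.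

Let mgi i : measurable_fun setT (gi i).
Proof.
exact: (measurableT_comp (measurable_tnth i) (measurable_funPT G)).
Qed.

Let psum (k : nat) : S -> measurableTypeR R :=
  fun s => \sum_(i < d | (i < k)%N) tnth w i * gi i s.

Let psq (k : nat) : R := \sum_(i < d | (i < k)%N) tnth w i ^+ 2.

Let mpsum k : measurable_fun setT (psum k).
Proof.
rewrite (_ : psum k = fun s => \sum_(i < d) if (i < k)%N then tnth w i * gi i s else 0).
  apply: (@measurable_sum _ _ R _ _ _
    (fun (i : 'I_d) s => if (i < k)%N then tnth w i * gi i s else 0)) => i.
  by case: (i < k)%N => //; apply: measurable_funM => //; exact: mgi.
by apply/funext => s; rewrite /psum big_mkcond.
Qed.

(** Induction absorbing one coordinate at a time. The coordinates from [k] on stay in the statement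
    because the next step needs the joint law of the partial sum, coordinate [k] and the rest. *)
Let psum_law (k : nat) : (k <= d)%N -> forall B (A : 'I_d -> set R),
  measurable B -> (forall i, measurable (A i)) ->
  Q ([set s | B (psum k s)] `&` [set s | forall i : 'I_d, (k <= i)%N -> A i (gi i s)]) =
    (N (affine 0 (Num.sqrt (psq k)) @^-1` B) * \prod_(i < d | (k <= i)%N) N (A i))%E.
Proof.
elim: k => [_|k IH kd] B A mB mA.
  rewrite /psq big_pred0// sqrtr0 -(gG mA).
  have psum0 s : psum 0 s = 0 by rewrite /psum big_pred0.
  (* The empty sum is [0] and [affine 0 0] is constant, so both sides only test whether [B] contains
     [0]. *)
  have [B0|B0] := pselect (B 0).
    rewrite (_ : _ @^-1` _ = setT); last first.
      by apply/seteqP; split => // x _ /=; rewrite /affine mul0r addr0.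
    rewrite probability_setT mul1e; congr (Q _).
    apply/seteqP; split => s /=; first by move=> [_ h] i; exact: h.
    by move=> h; split => [|i _]; [rewrite psum0|exact: h].
  rewrite (_ : _ @^-1` _ = set0); last first.
    by apply/seteqP; split => // x /=; rewrite /affine mul0r addr0.
  rewrite [X in (_ = X * _)%E]measure0 mul0e (_ : _ `&` _ = set0); first exact: measure0.
  by apply/seteqP; split => // s [/=]; rewrite psum0.
pose j := Ordinal kd.
pose E := [set s | forall i : 'I_d, (k < i)%N -> A i (gi i s)].
have mE : measurable E.
  rewrite (_ : E = \bigcap_(i in [set i : 'I_d | (k < i)%N]) (gi i @^-1` A i)).
    apply: fin_bigcap_measurable => // i _.
    rewrite -[X in measurable X]setTI; apply: mgi; first exact: measurableT.
    exact: mA.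
  by apply/funext => s; apply/propext; split => h i; exact: h.
pose e := (\prod_(i < d | (k < i)%N) N (A i))%E.
have e01 : (0 <= e <= 1)%E.
  rewrite /e; elim/big_ind : _ => [|x y /andP[x0 x1] /andP[y0 y1]|i _].
  - by rewrite lee01 lexx.
  - by rewrite mule_ge0// -[X in (_ <= X)%E]mul1e lee_pmul.
  - by apply/andP; split; [exact: measure_ge0|apply: probability_le1; exact: mA].
have efin : e \is a fin_num.
  move/andP : e01 => [e0 e1]; rewrite ge0_fin_numE// (le_lt_trans e1)// ltry//.
have e0 : 0 <= fine e by rewrite fine_ge0//; case/andP : e01.
have rect B' C : measurable B' -> measurable C ->
    Q ([set s | B' (psum k s) /\ C (gi j s)] `&` E) =
      ((NngNum e0)%:num%:E * N (affine 0 (Num.sqrt (psq k)) @^-1` B') * N C)%E.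
  move=> mB' mC; rewrite /= fineK//.
  (* Placing [C] in slot [j] makes the induction hypothesis a statement on the pair formed by the
     partial sum and coordinate [j]. *)
  pose A' i := if i == j then C else A i.
  have mA' i : measurable (A' i) by rewrite /A'; case: (i == j); [exact: mC|exact: mA].
  have := IH (ltnW kd) B' A' mB' mA'.
  rewrite (bigD1 j)//= {2}/A' eqxx.
  rewrite (eq_bigl (fun i : 'I_d => (k < i)%N)); last first.
    by move=> i; rewrite andbC -val_eqE/= ltn_neqAle eq_sym.
  rewrite (eq_bigr (fun i => N (A i))); last first.
    by move=> i ki; rewrite /A' -val_eqE/= gtn_eqF.
  rewrite -/e => IH'; rewrite -[RHS]muleA [RHS]muleC -[RHS]muleA -IH'; congr (Q _).
  apply/funext => s; apply/propext; split => -[].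
    move=> [Bs Cs] Es; split => // i ki; rewrite /A'.
    case: eqP => [->//|/eqP ij]; apply: Es.
    by rewrite ltn_neqAle ki andbT; apply: contra ij => /eqP kiE; apply/eqP/val_inj.
  move=> Bs As; split; first by split => //; have := As j (leqnn _); rewrite /A' eqxx.
  by move=> i ki; have := As i (ltnW ki); rewrite /A' -val_eqE/= gtn_eqF.
have ltS (i : 'I_d) : (i < k.+1)%N && (i != j) = (i < k)%N.
  by rewrite ltnS andbC -val_eqE/= ltn_neqAle.
have psumS s : psum k.+1 s = psum k s + tnth w j * gi j s.
  by rewrite /psum (bigD1 j)//= addrC (eq_bigl _ _ ltS).
have psqS : psq k.+1 = psq k + tnth w j ^+ 2.
  by rewrite /psq (bigD1 j)//= addrC (eq_bigl _ _ ltS).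
have psq0 : 0 <= psq k by rewrite sumr_ge0// => i _; rewrite sqr_ge0.
have := joint_gaussian_rotation (mpsum k) (@mgi j) mE (sqrtr_ge0 _) rect (tnth w j) mB.
rewrite sqr_sqrtr// -psqS /= fineK// muleC => <-; congr (Q _).
by apply/funext => s; apply/propext; split => -[]; rewrite /= psumS.
Qed.

Lemma gaussian_dotp_law B : measurable B ->
  Q [set s | B (dotp w (G s))] = N (affine 0 (norm2 w) @^-1` B).
Proof.
move=> mB; have := psum_law (leqnn d) mB (fun=> measurableT).
rewrite big_pred0 ?mule1; last by move=> i; rewrite leqNgt ltn_ord.
have -> : psq d = dotp w w.
  by apply: eq_big => [i|i _]; [exact: ltn_ord|rewrite expr2].
move=> <-; congr (Q _); apply/funext => s; apply/propext.
have dE : psum d s = dotp w (G s) by apply: eq_bigl => i; exact: ltn_ord.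
split => [Bs|[]] /=; last by rewrite dE.
by split; [rewrite /= dE|move=> i _].
Qed.

End GaussianLaw.

(** * Polygonal approximation of convex functions *)

Section Subgradient.
Context {R : realType}.
Variable phi : R -> R.
Hypothesis cvx : convex_function [set: R^o] phi.
Implicit Types x y q t : R.

Lemma convex_functionW t x y : 0 <= t <= 1 ->
  phi (t * x + (1 - t) * y) <= t * phi x + (1 - t) * phi y.
Proof.
move=> /andP[t0 t1].
by have := @cvx (Itv01 t0 t1) x y; rewrite !inE => /(_ I I).
Qed.

Lemma convex_slope x q y : x < q -> q < y ->
  (phi q - phi x) / (q - x) <= (phi y - phi q) / (y - q).
Proof.
move=> xq qy.
have yx0 : 0 < y - x by rewrite subr_gt0 (lt_trans xq).
have qx0 : 0 < q - x by rewrite subr_gt0.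
have yq0 : 0 < y - q by rewrite subr_gt0.
have t01 : 0 <= (y - q) / (y - x) <= 1.
  by rewrite divr_ge0 ?(ltW yq0) ?(ltW yx0)//= ler_pdivrMr// mul1r lerD2l lerN2 ltW.
have := convex_functionW x y t01.
have -> : (y - q) / (y - x) * x + (1 - (y - q) / (y - x)) * y = q.
  by field; rewrite gt_eqF.
rewrite -(ler_pM2r yx0).
have -> : ((y - q) / (y - x) * phi x + (1 - (y - q) / (y - x)) * phi y) * (y - x) =
    (y - q) * phi x + (q - x) * phi y.
  by field; rewrite gt_eqF.
move=> h; rewrite ler_pdivrMr// mulrAC ler_pdivlMr//.
by lra.
Qed.

(** The witness is the supremum of the chord slopes to the left of [q]; by [convex_slope] every
    chord slope to the right bounds them. *)
Lemma subgradient_exists q : exists s, forall y, phi q + s * (y - q) <= phi y.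
Proof.
pose E := [set (phi q - phi x) / (q - x) | x in [set x | x < q]].
have ubE y : q < y -> ubound E ((phi y - phi q) / (y - q)).
  by move=> qy _ [x xq <-]; exact: convex_slope.
have hE : has_sup E.
  split; first by exists ((phi q - phi (q - 1)) / (q - (q - 1))), (q - 1) => //=; lra.
  by exists ((phi (q + 1) - phi q) / (q + 1 - q)); apply: ubE; lra.
exists (sup E) => y; have [yq|qy|->] := ltgtP y q.
- have : (phi q - phi y) / (q - y) <= sup E by apply: ub_le_sup; [case: hE|exists y].
  by rewrite ler_pdivrMr ?subr_gt0//; lra.
- have : sup E <= (phi y - phi q) / (y - q) by apply: ge_sup; [case: hE|exact: ubE].
  by rewrite ler_pdivlMr ?subr_gt0//; lra.
- by rewrite subrr mulr0 addr0.
Qed.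

Definition subgradient q : R := sval (cid (subgradient_exists q)).

Definition tangent q y : R := phi q + subgradient q * (y - q).

Lemma tangent_le q y : tangent q y <= phi y.
Proof. by rewrite /tangent /subgradient; case: cid => s /= ->. Qed.

Lemma subgradient_le p q : p <= q -> subgradient p <= subgradient q.
Proof.
rewrite le_eqVlt => /predU1P[->//|pq].
have := tangent_le p q; have := tangent_le q p; rewrite /tangent => h1 h2.
have qp : 0 < q - p by rewrite subr_gt0.
by rewrite -(ler_pM2r qp); lra.
Qed.

(** Tangents at [p <= q] cross between [p] and [q]: this lemma covers the right of [q], the next one
    the left of [p]. *)
Lemma tangent_ge p q y : p <= q -> q <= y -> tangent p y <= tangent q y.
Proof.
move=> pq qy; have yq : 0 <= y - q by rewrite subr_ge0.
have := ler_wpM2r yq (subgradient_le pq); have := tangent_le p q.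
by rewrite /tangent; lra.
Qed.

Lemma tangent_le_left p q y : p <= q -> y <= p -> tangent q y <= tangent p y.
Proof.
move=> pq yp; have py : 0 <= p - y by rewrite subr_ge0.
have := ler_wpM2r py (subgradient_le pq); have := tangent_le q p.
by rewrite /tangent; lra.
Qed.

(* For nondecreasing [g], this is the maximum of the tangents at [g 0], ..., [g m]. *)
Definition polygon (g : nat -> R) (m : nat) y : R :=
  tangent (g 0%N) y + \sum_(0 <= i < m) hinge (tangent (g i.+1) y - tangent (g i) y).

Lemma polygonS g m y : polygon g m.+1 y =
  polygon g m y + hinge (tangent (g m.+1) y - tangent (g m) y).
Proof. by rewrite /polygon big_nat_recr//= addrA. Qed.

Lemma tangent_le_polygon g m i y : (i <= m)%N -> tangent (g i) y <= polygon g m y.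
Proof.
elim: m i => [|m IH] i.
  by rewrite leqn0 => /eqP ->; rewrite /polygon big_nil addr0.
rewrite polygonS leq_eqVlt => /predU1P[->|/IH h].
  have := IH m (leqnn m); have := le_hinge (tangent (g m.+1) y - tangent (g m) y).
  by lra.
by rewrite ler_wpDr// hinge_ge0.
Qed.

Lemma polygon_le g m y : {homo g : i j / (i <= j)%N >-> i <= j} -> polygon g m y <= phi y.
Proof.
move=> gh.
(* Strengthened for the induction: right of [g m] the next hinge lifts the last tangent to the
   maximum of two tangents, and left of [g m] it vanishes. *)
suff [] : polygon g m y <= phi y /\ (g m <= y -> polygon g m y = tangent (g m) y) by [].
elim: m => [|m [IH1 IH2]].
  by rewrite /polygon big_nil addr0; split => //; exact: tangent_le.
have gm : g m <= g m.+1 by exact: gh.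
rewrite polygonS; have [gy|/ltW yg] := leP (g m) y.
  rewrite IH2// /hinge; split => [|gy1].
    rewrite -lerBrDl ge_max lerB ?tangent_le//= subr_ge0; exact: tangent_le.
  by rewrite max_l ?subr_ge0; [lra|exact: tangent_ge].
rewrite ler0_hinge ?subr_le0 ?tangent_le_left// addr0; split => // gy1.
have gE : g m = g m.+1 by apply/eqP; rewrite eq_le gm (le_trans gy1 yg).
by rewrite IH2 gE.
Qed.

(** Index [n * n.+1] is the point [0] and index [2 * n * n.+1] is [n], so [interpolant] uses
    tangents across [[-n, n]]. *)
Definition grid (n i : nat) : R := - n%:R + i%:R / n.+1%:R.

Definition interpolant n y : R := polygon (grid n) (2 * n * n.+1) y.

Lemma interpolant_le n y : interpolant n y <= phi y.
Proof.
apply: polygon_le => i j ij.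
by rewrite lerD2l ler_pM2r ?invr_gt0 ?ltr0n// ler_nat.
Qed.

(** Since [0] belongs to every grid, its tangent is an affine minorant common to all interpolants;
    Fatou's lemma will need the nonnegative differences. *)
Lemma tangent0_le_interpolant n y : tangent 0 y <= interpolant n y.
Proof.
have -> : 0 = grid n (n * n.+1) :> R.
  by rewrite /grid natrM mulfK ?pnatr_eq0// addNr.
apply: tangent_le_polygon; rewrite -mulnA; lia.
Qed.

(** Let [q] be the last grid point up to [y], at distance at most [1 / (n + 1)]. Its tangent misses
    [phi y] by at most the increase of subgradients from [q] to [y] times that distance, and the
    increase is at most [C] because [y - 1 <= q]. *)
Lemma cvg_interpolant y : interpolant n y @[n --> \oo] --> phi y.
Proof.
pose C := subgradient y - subgradient (y - 1).
have cC : phi y - C * n.+1%:R^-1 @[n --> \oo] --> (phi y : R).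
  rewrite -[X in _ --> X]subr0; apply: cvgB; first exact: cvg_cst.
  rewrite -(mulr0 C); apply: cvgM; first exact: cvg_cst.
  exact: cvg_harmonic.
apply: (@squeeze_cvgr _ _ _ _ (fun n => phi y - C * n.+1%:R^-1) (cst (phi y))) => //;
  last exact: cvg_cst.
near=> n; rewrite interpolant_le andbT.
have ny : `|y| <= n%:R by near: n; exact: nbhs_infty_ger.
move: ny; rewrite ler_norml => /andP[ny1 ny2].
have n0 : 0 < n.+1%:R :> R by rewrite ltr0n.
pose r := (y + n%:R) * n.+1%:R.
have r0 : 0 <= r by rewrite mulr_ge0//; lra.
pose i := Num.trunc r.
have ir : i%:R <= r by rewrite truncn_le.
have ri : r < i.+1%:R by exact: truncnS_gt.
have im : (i <= 2 * n * n.+1)%N.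
  rewrite -(ler_nat R) (le_trans ir)// natrM ler_pM2r// natrM; lra.
apply: le_trans (tangent_le_polygon (grid n) y im).
pose q := grid n i.
have qy : q <= y.
  by rewrite /q /grid addrC lerBlDr ler_pdivrMr.
have yq : y - q <= n.+1%:R^-1.
  rewrite /q /grid -[leRHS]mul1r ler_pdivlMr// mulrBl mulrDl divfK ?gt_eqF//.
  by move: ri; rewrite /r mulrDl -natr1; lra.
have yq0 : 0 <= y - q by rewrite subr_ge0.
have inv1 : n.+1%:R^-1 <= 1 :> R by rewrite invf_le1// ler1n.
have sq : subgradient (y - 1) <= subgradient q.
  by apply: subgradient_le; rewrite lerBlDl -lerBlDr (le_trans yq).
have C0 : 0 <= C by rewrite subr_ge0 subgradient_le// gerBl.
have h1 := tangent_le y q; have h2 := ler_wpM2r yq0 sq; have h3 := ler_wpM2l C0 yq.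
move: h1 h2 h3; rewrite -/q /tangent /C; clearbody q; move: (n.+1%:R^-1 : R) => v; clear; lra.
Unshelve. all: by end_near. Qed.

Lemma measurable_tangent q : measurable_fun [set: R] (tangent q).
Proof.
by apply: measurable_funD => //; apply: measurable_funM => //; exact: measurable_funB.
Qed.

Lemma measurable_interpolant n : measurable_fun [set: R] (interpolant n).
Proof.
apply: measurable_funD; first exact: measurable_tangent.
apply: measurable_sum => i; apply: measurableT_comp; first exact: measurable_hinge.
by apply: measurable_funB; exact: measurable_tangent.
Qed.

Lemma measurable_convex : measurable_fun [set: R] phi.
Proof.
apply: (@measurable_fun_cvg _ _ _ _ interpolant) => [n|y _]; first exact: measurable_interpolant.
exact: cvg_interpolant.
Qed.

End Subgradient.

(** Fatou rather than monotone convergence: the grids are not nested, so interpolants need not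
    increase with [n]. *)
Lemma integral_cvg_le d (T : measurableType d) (R : realType)
    (mu : {measure set T -> \bar R}) (f : nat -> T -> R) (g : T -> R) (M : \bar R) :
  (forall n, measurable_fun setT (f n)) -> (forall n x, 0 <= f n x) ->
  (forall x, f n x @[n --> \oo] --> g x) ->
  (forall n, \int[mu]_x (f n x)%:E <= M)%E -> (\int[mu]_x (g x)%:E <= M)%E.
Proof.
move=> mf f0 fg fM.
have := @fatou _ T R mu setT measurableT (fun n x => (f n x)%:E).
move=> /(_ (fun n => (iffRL (measurable_EFinP _ _) (mf n))) (fun n x _ => f0 n x)).
under eq_integral => x _.
  have := (@cvg_limn_einf_sup R (fun n => (f n x)%:E) (g x)%:E).
  move=> ->; last by apply: cvg_EFin; [exact: nearW|exact: fg].
  over.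
move=> /le_trans; apply.
rewrite limn_einf_lim; apply: lime_le; first exact: is_cvg_einfs.
by apply: nearW => n; apply: le_trans (fM n); apply: ereal_inf_lbound; exists n => /=.
Qed.

(** * Stop-loss transforms of Gaussian vectors *)

Section VectorOps.
Context {R : realType} {d : nat}.
Implicit Types (u x : d.-tuple R) (c : R).

Lemma dotp_scalel c u x : dotp (scalev c u) x = c * dotp u x.
Proof. by rewrite /dotp mulr_sumr; apply: eq_bigr => i _; rewrite tnth_mktuple mulrA. Qed.

Lemma dotp_scaler c u x : dotp u (scalev c x) = c * dotp u x.
Proof. by rewrite /dotp mulr_sumr; apply: eq_bigr => i _; rewrite tnth_mktuple mulrCA. Qed.

Lemma norm2_scale c u : norm2 (scalev c u) = `|c| * norm2 u.
Proof. by rewrite /norm2 dotp_scalel dotp_scaler mulrA sqrtrM ?sqrtr_sqr -?expr2 ?sqr_ge0. Qed.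

Lemma norm2_eq0 u x : norm2 u = 0 -> dotp u x = 0.
Proof.
have sq0 : 0 <= dotp u u by apply: sumr_ge0 => i _; rewrite -expr2 sqr_ge0.
move=> /eqP; rewrite sqrtr_eq0 => le0.
have /eqP : dotp u u = 0 by apply/eqP; rewrite eq_le le0.
rewrite psumr_eq0 => [/allP h|i _]; last by rewrite -expr2 sqr_ge0.
rewrite /dotp big1// => i _; have := h i (mem_index_enum _).
by rewrite mulf_eq0 orbb => /eqP ->; rewrite mul0r.
Qed.

Lemma measurable_dotp u : measurable_fun [set: d.-tuple R] (dotp u).
Proof.
apply: (@measurable_sum _ _ R _ _ _ (fun (i : 'I_d) (x : d.-tuple R) => tnth u i * tnth x i)) => i.
by apply: measurable_funM => //; exact: measurable_tnth.
Qed.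

Lemma measurable_scalev c : measurable_fun [set: d.-tuple R] (scalev c).
Proof.
apply/measurable_fun_tnthP => i.
rewrite (_ : _ \o _ = (fun x : d.-tuple R => c * tnth x i)).
  by apply: measurable_funM => //; exact: measurable_tnth.
by apply/funext => x /=; rewrite tnth_mktuple.
Qed.

End VectorOps.

Section IntegrableVector.
Context {R : realType} {d : nat} {dT : measure_display} {T : measurableType dT}.
Variables (P : probability T R) (X : {RV P >-> d.-tuple R}).
Hypotheses (iX : integrable_vector P X) (cX : centered P X).

Lemma integrable_dotp u : P.-integrable setT (EFin \o (fun w => dotp u (X w))).
Proof.
rewrite (_ : _ \o _ = (fun w => \sum_(i < d) ((tnth u i)%:E * (tnth (X w) i)%:E))%E); last first.
  by apply/funext => w /=; rewrite /dotp sumEFin.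
by apply: integrable_sum => // i _; apply: integrableZl.
Qed.

Lemma Rintegral_dotp u : \int[P]_w dotp u (X w) = 0.
Proof.
rewrite /Rintegral (_ : integral _ _ _ = 0%E)//.
under eq_integral do rewrite /dotp -sumEFin.
rewrite integral_sum//; last first.
  by move=> i; exact: (integrable_EFinZ (tnth u i) (iX i)).
rewrite big1// => i _; under eq_integral do rewrite EFinM.
rewrite integralZl//; have := cX i; rewrite unlock => ->.
by rewrite mule0.
Qed.

End IntegrableVector.

Section GaussianHinge.
Context {R : realType} {dS : measure_display} {S : measurableType dS}.
Variable Q : probability S R.

Lemma cvg_stoploss_y (c : R) : 0 < c -> stoploss c s @[s --> +oo] --> (0 : R).
Proof.
move=> c0.
apply: (@squeeze_cvgr _ _ _ _ (cst 0) (fun s => c * gnorm * gexp (s / c))).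
- near=> s; have s0 : 0 <= s by near: s; exact: nbhs_pinfty_ge.
  rewrite stoploss_ge0//= /stoploss mulrA lerBlDr lerDl.
  by rewrite mulr_ge0// mulr_ge0 ?gupper_ge0// ltW// gnorm_gt0.
- exact: cvg_cst.
- rewrite -(mulr0 (c * gnorm)); apply: cvgM; first exact: cvg_cst.
  apply: cvg_comp cvg_gexp_y; apply: gt0_cvgMly; first by rewrite invr_gt0.
  exact: cvg_id.
Unshelve. all: by end_near. Qed.

(** By the layer-cake formula, since [- stoploss c (s + t)] is an antiderivative in [t] of the tail
    at [s + t]. *)
Lemma integral_hinge_gaussian (Z : S -> R) (c s : R) : measurable_fun setT Z -> 0 < c ->
  (forall t, Q [set w | t < Z w] = (gnorm * gupper (t / c))%:E) ->
  (\int[Q]_w (hinge (Z w - s))%:E = (stoploss c s)%:E)%E.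
Proof.
move=> mZ c0 lawZ; have cn0 : c != 0 by rewrite gt_eqF.
have mH : measurable_fun setT (fun w => hinge (Z w - s)).
  apply: measurableT_comp; first exact: measurable_hinge.
  exact: measurable_funB.
have [-> _] := ge0_integral_tail Q mH (fun w => hinge_ge0 _).
have E (t : R) : 0 <= t -> Q [set w | t < hinge (Z w - s)] = (gnorm * gupper ((s + t) / c))%:E.
  move=> t0; rewrite -lawZ; congr (Q _); apply/seteqP.
  by split => w /=; rewrite /hinge lt_max [t < 0]ltNge t0/= orbF ltrBrDl.
transitivity (\int[lebesgue_measure]_(t in `[0%R, +oo[) (gnorm * gupper ((s + t) / c))%:E)%E.
  by apply: eq_integral => t; rewrite inE/= in_itv/= andbT => /E.
pose f t := gnorm * gupper ((s + t) / c).
pose F t := - stoploss c (s + t).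
have dF (t : R) : is_derive t 1 F (f t).
  have dl : is_derive t 1 (fun t : R => s + t) 1.
    by rewrite -[X in is_derive _ _ _ X](add0r (1 : R)); apply: is_deriveD.
  have dS' := @is_derive1_comp R (stoploss c) (fun t : R => s + t) t _ _
    (is_derive_stoploss (s + t) cn0) dl.
  by have := is_deriveN dS'; rewrite mulr1 opprK.
have cf : continuous f.
  move=> t; apply: cvgM; first exact: cvg_cst.
  apply: (@continuous_comp R R R (fun t : R => (s + t) / c) gupper t); last exact: continuous_gupper.
  by apply: cvgM; [apply: cvgD; [exact: cvg_cst|exact: cvg_id]|exact: cvg_cst].
rewrite (@ge0_continuous_FTC2y R f F 0 0).
- by rewrite /F addr0 sub0e -EFinN opprK.
- by move=> t _; rewrite mulr_ge0 ?gupper_ge0// ltW// gnorm_gt0.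
- exact: continuous_subspaceT.
- rewrite -oppr0; apply: cvgN; apply: cvg_comp (cvg_stoploss_y c0); exact: cvg_addrl.
- by move=> t _; have [] := dF t.
- by apply: cvg_at_right_filter; exact: is_derive_continuous (dF 0).
- by move=> t _; rewrite derive1E; have [_ ->] := dF t.
Qed.

Context {d : nat}.
Variable G : {RV Q >-> d.-tuple R}.
Hypothesis gG : standard_gaussian Q G.

Lemma integral_hinge_dotp_gaussian (c s : R) (v : d.-tuple R) : 0 < c -> norm2 v = 1 ->
  (\int[Q]_w (hinge (dotp v (scalev c (G w)) - s))%:E = (stoploss c s)%:E)%E.
Proof.
move=> c0 v1; apply: integral_hinge_gaussian => // [|t].
  apply: (measurableT_comp (measurable_dotp v)).
  by apply: (measurableT_comp (measurable_scalev c)); exact: measurable_funPT.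
have := gaussian_dotp_law gG v (measurable_itv `]t / c, +oo[).
rewrite v1 (_ : affine 0 1 @^-1` _ = `]t / c, +oo[%classic); last first.
  by apply/seteqP; split => x /=; rewrite /affine add0r mul1r.
rewrite gaussian_ray => <-; congr (Q _).
by apply/seteqP; split => w /=; rewrite in_itv/= andbT dotp_scaler ltr_pdivrMr// mulrC.
Qed.

(** The positive and negative parts both have expectation [stoploss c 0], the latter through the
    unit vector [-v]; it is finite, and the two cancel. *)
Lemma gaussian_dotp_unit_centered (c : R) (v : d.-tuple R) : 0 < c -> norm2 v = 1 ->
  Q.-integrable setT (EFin \o (fun w => dotp v (scalev c (G w)))) /\
  \int[Q]_w dotp v (scalev c (G w)) = 0.
Proof.
move=> c0 v1; pose Z w := dotp v (scalev c (G w)).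
have mZ : measurable_fun setT Z.
  apply: (measurableT_comp (measurable_dotp v)).
  by apply: (measurableT_comp (measurable_scalev c)); exact: measurable_funPT.
have Nv1 : norm2 (scalev (-1) v) = 1 by rewrite norm2_scale normrN normr1 mul1r.
have h1 := integral_hinge_dotp_gaussian 0 c0 v1.
have h2 := integral_hinge_dotp_gaussian 0 c0 Nv1.
have E1 w : hinge (dotp v (scalev c (G w)) - 0) = hinge (Z w) by rewrite subr0.
have E2 w : hinge (dotp (scalev (-1) v) (scalev c (G w)) - 0) = hinge (- Z w).
  by rewrite subr0 dotp_scalel mulN1r.
rewrite (eq_integral _ _ (fun w _ => congr1 EFin (E1 w))) in h1.
rewrite (eq_integral _ _ (fun w _ => congr1 EFin (E2 w))) in h2.
have mH (f : S -> R) : measurable_fun setT f -> measurable_fun setT (fun w => hinge (f w)).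
  by move=> mf; apply: measurableT_comp => //; exact: measurable_hinge.
have iH (f : S -> R) : measurable_fun setT f ->
    (\int[Q]_w (hinge (f w))%:E = (stoploss c 0)%:E)%E ->
    Q.-integrable setT (EFin \o (fun w => hinge (f w))).
  move=> mf fE; apply/integrableP; split; first by apply/measurable_EFinP; exact: mH.
  under eq_integral do rewrite /= ger0_norm ?hinge_ge0//.
  by rewrite fE ltry.
have i1 := iH _ mZ h1.
have mNZ : measurable_fun setT (fun w => - Z w) by exact: measurableT_comp.
have i2 := iH _ mNZ h2.
have ZE w : Z w = hinge (Z w) - hinge (- Z w) by rewrite hingeN opprB addrC subrK.
have iN : Q.-integrable setT (EFin \o (fun w => - hinge (- Z w))).
  by have := integrable_EFinZ (-1) i2; under eq_fun do rewrite mulN1r.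
split.
  rewrite (_ : _ \o _ = EFin \o (fun w => hinge (Z w) + - hinge (- Z w))).
    exact: integrable_EFinD.
  by apply/funext => w /=; rewrite -ZE.
transitivity (\int[Q]_w (hinge (Z w) - hinge (- Z w))).
  by apply: eq_Rintegral => w _; rewrite -ZE.
rewrite RintegralB//; apply/eqP; rewrite subr_eq0; apply/eqP.
by rewrite /Rintegral h1 h2.
Qed.

Lemma gaussian_dotp_centered (c : R) (u : d.-tuple R) : 0 < c ->
  Q.-integrable setT (EFin \o (fun w => dotp u (scalev c (G w)))) /\
  \int[Q]_w dotp u (scalev c (G w)) = 0.
Proof.
move=> c0; have [u0|u0] := eqVneq (norm2 u) 0.
  have E w : dotp u (scalev c (G w)) = 0 by exact: norm2_eq0.
  rewrite (_ : (fun w => dotp u (scalev c (G w))) = cst 0); last exact/funext.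
  by split; [exact: integrable_cstP|rewrite Rintegral_cst// mul0r].
pose v := scalev (norm2 u)^-1 u.
have v1 : norm2 v = 1 by rewrite norm2_scale normfV ger0_norm ?sqrtr_ge0// mulVf.
have uE w : dotp u (scalev c (G w)) = norm2 u * dotp v (scalev c (G w)).
  by rewrite dotp_scalel mulrA divff// mul1r.
have [iv v0] := gaussian_dotp_unit_centered c0 v1.
rewrite (_ : (fun w => dotp u (scalev c (G w))) =
    fun w => norm2 u * dotp v (scalev c (G w))); last first.
  exact/funext.
by split; [exact: integrable_EFinZ|rewrite RintegralZl// v0 mulr0].
Qed.

End GaussianHinge.

(** * From hinges to convex functions *)

Section Minorant.
Context {d : measure_display} {T : measurableType d} {R : realType}.
Variable P : probability T R.

(** Additivity of the integral when [h] may have infinite expectation. *)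
Lemma integral_minorant (h l : T -> R) : measurable_fun setT h ->
  P.-integrable setT (EFin \o l) -> (forall w, l w <= h w) ->
  (\int[P]_w (h w)%:E = \int[P]_w (h w - l w)%:E + (\int[P]_w l w)%:E)%E.
Proof.
move=> mh il lh.
have ml : measurable_fun setT l by apply/measurable_EFinP; exact: (measurable_int P il).
have mhl : measurable_fun setT (fun w => h w - l w) by exact: measurable_funB.
have hl0 w : (0 <= (h w - l w)%:E)%E by rewrite lee_fin subr_ge0.
have [ioo|] := ltP (\int[P]_w (h w - l w)%:E)%E +oo%E.
  have ihl : P.-integrable setT (EFin \o (fun w => h w - l w)).
    apply/integrableP; split; first exact/measurable_EFinP.
    rewrite (eq_integral (fun w => (h w - l w)%:E))// => w _; apply: gee0_abs; exact: hl0.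
  rewrite -EFin_Rintegral// -integralD//.
  by apply: eq_integral => w _ /=; rewrite -EFinD subrK.
(* The negative part of [h] is at most that of [l], hence integrable; were the positive part
   integrable too, so would be [h] and then [h - l]. *)
rewrite leye_eq => /eqP ioo; rewrite ioo addye//.
have ineg : P.-integrable setT (EFin \o h)^\-%E.
  apply: (le_integrable _ _ _ (integrable_funeneg measurableT il)) => //.
    by apply: measurable_funeneg; exact/measurable_EFinP.
  move=> w _; rewrite !gee0_abs ?funeneg_ge0//.
  rewrite !funenegE ge_max; apply/andP; split; rewrite le_max ?lexx ?orbT//.
  by rewrite leeN2 lee_fin lh.
rewrite integralE (_ : \int[P]_w (_^\+ w) = +oo)%E.
  have := integrable_fin_num measurableT ineg.
  by rewrite -fin_numN fin_numE => /andP[nNoo _]; rewrite addye.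
apply/eqP; rewrite -leye_eq leNgt; apply/negP => pos.
have ipos : P.-integrable setT (EFin \o h)^\+%E.
  apply/integrableP; split; first by apply: measurable_funepos; exact/measurable_EFinP.
  by rewrite (eq_integral ((EFin \o h)^\+)%E)// => w _; rewrite gee0_abs ?funepos_ge0.
have ih : P.-integrable setT (EFin \o h).
  by rewrite (funeposneg (EFin \o h)); exact: integrableB.
have : P.-integrable setT (EFin \o (fun w => h w - l w)) by exact: (integrableB measurableT ih il).
by move=> /(integrable_fin_num measurableT); rewrite /comp ioo.
Qed.

End Minorant.

Section HingeReflection.
Context {d : measure_display} {T : measurableType d} {R : realType}.
Variable P : probability T R.

(** Trades the threshold [s] of [Y] for the threshold [-s] of [-Y], at the cost of
    [E (Y - s) = -s]. *)
Lemma Rintegral_hinge_reflect (Y : T -> R) (s : R) :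
  P.-integrable setT (EFin \o Y) -> \int[P]_w Y w = 0 ->
  \int[P]_w hinge (Y w - s) = \int[P]_w hinge (-1 * Y w - - s) - s.
Proof.
move=> iY Y0.
have iA : P.-integrable setT (EFin \o (fun w => 1 * Y w + - s)) by exact: integrable_affine.
have iB : P.-integrable setT (EFin \o (fun w => -1 * Y w + - - s)) by exact: integrable_affine.
have E w : hinge (Y w - s) = hinge (-1 * Y w - - s) + (1 * Y w + - s).
  rewrite (_ : -1 * Y w - - s = - (Y w - s)); last by ring.
  by rewrite hingeN; ring.
rewrite (eq_Rintegral P (fun w _ => E w)) RintegralD//; last exact: integrable_hinge.
by rewrite Rintegral_affine// Y0 mulr0 add0r.
Qed.

End HingeReflection.

Section ConvexDomination.
Context {R : realType} {dT dS : measure_display}.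
Context {T : measurableType dT} {S : measurableType dS}.
Variables (P : probability T R) (Q : probability S R).
Variables (Y : T -> R) (Z : S -> R).
Hypotheses (iY : P.-integrable setT (EFin \o Y)) (iZ : Q.-integrable setT (EFin \o Z)).
Hypothesis YZ : \int[P]_w Y w = \int[Q]_w Z w.
Hypothesis hingeYZ : forall a b : R,
  \int[P]_w hinge (a * Y w + b) <= \int[Q]_w hinge (a * Z w + b).
Variable phi : R -> R.
Hypothesis cvx : convex_function [set: R^o] phi.

Let tangentE q y : tangent cvx q y = subgradient cvx q * y + (phi q - subgradient cvx q * q).
Proof. by rewrite /tangent; ring. Qed.

Let tangentBE p q y : tangent cvx q y - tangent cvx p y =
  (subgradient cvx q - subgradient cvx p) * y +
  ((phi q - subgradient cvx q * q) - (phi p - subgradient cvx p * p)).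
Proof. by rewrite /tangent; ring. Qed.

(** Each hinge is applied to a difference of two tangents, which is affine, so [hingeYZ] compares
    it; the initial tangent has equal expectations by [YZ]. *)
Let polygon_cmp g m : [/\ P.-integrable setT (EFin \o (fun w => polygon cvx g m (Y w))),
  Q.-integrable setT (EFin \o (fun w => polygon cvx g m (Z w))) &
  \int[P]_w polygon cvx g m (Y w) <= \int[Q]_w polygon cvx g m (Z w)].
Proof.
elim: m => [|m [IP IQ IH]].
  set a := subgradient cvx (g 0%N); set b := phi (g 0%N) - a * g 0%N.
  have E (V : Type) (y : V -> R) : (fun w => polygon cvx g 0 (y w)) = (fun w => a * y w + b).
    by apply/funext => w; rewrite /polygon big_nil addr0 tangentE.
  rewrite !E; split; [exact: integrable_affine|exact: integrable_affine|].
  by rewrite !Rintegral_affine// YZ.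
set a := subgradient cvx (g m.+1) - subgradient cvx (g m).
set b := phi (g m.+1) - subgradient cvx (g m.+1) * g m.+1 -
  (phi (g m) - subgradient cvx (g m) * g m).
have E (V : Type) (y : V -> R) : (fun w => polygon cvx g m.+1 (y w)) =
    (fun w => polygon cvx g m (y w) + hinge (a * y w + b)).
  by apply/funext => w; rewrite polygonS tangentBE.
have iHP : P.-integrable setT (EFin \o (fun w => hinge (a * Y w + b))).
  by apply: integrable_hinge; exact: integrable_affine.
have iHQ : Q.-integrable setT (EFin \o (fun w => hinge (a * Z w + b))).
  by apply: integrable_hinge; exact: integrable_affine.
rewrite !E; split; [exact: integrable_EFinD|exact: integrable_EFinD|].
rewrite (RintegralD measurableT IP iHP) (RintegralD measurableT IQ iHQ).
by rewrite lerD// hingeYZ.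
Qed.

Let mYZ : measurable_fun setT Y /\ measurable_fun setT Z.
Proof.
by split; apply/measurable_EFinP; [exact: (measurable_int P iY)|exact: (measurable_int Q iZ)].
Qed.

Lemma convex_domination :
  (\int[P]_w (phi (Y w) - tangent cvx 0 (Y w))%:E <=
   \int[Q]_w (phi (Z w) - tangent cvx 0 (Z w))%:E)%E.
Proof.
have [mY mZ] := mYZ.
have mt := measurable_tangent cvx 0.
pose f n y := interpolant cvx n y - tangent cvx 0 y.
have mf n : measurable_fun setT (f n).
  by apply: measurable_funB => //; exact: measurable_interpolant.
have f0 n y : 0 <= f n y by rewrite subr_ge0 tangent0_le_interpolant.
apply: (@integral_cvg_le _ T R P (fun n w => f n (Y w))).
- by move=> n; exact: measurableT_comp.
- by move=> n w; exact: f0.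
- by move=> w; apply: cvgB; [exact: cvg_interpolant|exact: cvg_cst].
move=> n; apply: (@le_trans _ _ (\int[Q]_w (f n (Z w))%:E)%E); last first.
  apply: ge0_le_integral => //.
  - by move=> w _; rewrite lee_fin f0.
  - by apply/measurable_EFinP; exact: measurableT_comp.
  - apply/measurable_EFinP; apply: measurable_funB; last exact: measurableT_comp.
    by apply: measurableT_comp => //; exact: measurable_convex cvx.
  - by move=> w _; rewrite lee_fin lerD2r interpolant_le.
have [IP IQ le1] := polygon_cmp (grid n) (2 * n * n.+1).
set a := subgradient cvx 0; set b := phi 0 - a * 0.
have E (V : Type) (y : V -> R) : (fun w => f n (y w)) =
    (fun w => polygon cvx (grid n) (2 * n * n.+1) (y w) - (a * y w + b)).
  by apply/funext => w; rewrite /f tangentE.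
have iaY := integrable_affine a b iY; have iaZ := integrable_affine a b iZ.
have ifY : P.-integrable setT (EFin \o (fun w => f n (Y w))).
  by rewrite E; exact: (integrableB measurableT IP iaY).
have ifZ : Q.-integrable setT (EFin \o (fun w => f n (Z w))).
  by rewrite E; exact: (integrableB measurableT IQ iaZ).
rewrite !EFin_Rintegral// lee_fin !E !RintegralB// !Rintegral_affine// YZ.
by rewrite lerD2r.
Qed.

End ConvexDomination.

(** * Comparison of the two vectors *)

Section Comparison.
Context {R : realType} {d : nat} {dT dS : measure_display}.
Context {T : measurableType dT} {S : measurableType dS}.
Variables (P : probability T R) (X : {RV P >-> d.-tuple R}).
Variables (Q : probability S R) (G : {RV Q >-> d.-tuple R}).
Hypotheses (iX : integrable_vector P X) (cX : centered P X).
Hypotheses (tX : subgaussian_tails P X) (gG : standard_gaussian Q G).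
Implicit Types (u v : d.-tuple R).

Let cG w : d.-tuple R := scalev (c0 R) (G w).

Let iY u : P.-integrable setT (EFin \o (fun w => dotp u (X w))).
Proof. exact: integrable_dotp. Qed.

Let Y0 u : \int[P]_w dotp u (X w) = 0. Proof. exact: Rintegral_dotp. Qed.

Let iZ u : Q.-integrable setT (EFin \o (fun w => dotp u (cG w))).
Proof. by have [] := gaussian_dotp_centered gG u (@c0_gt0 R). Qed.

Let Z0 u : \int[Q]_w dotp u (cG w) = 0.
Proof. by have [] := gaussian_dotp_centered gG u (@c0_gt0 R). Qed.

Let hinge_unit_ge0 v (s : R) : norm2 v = 1 -> 0 <= s ->
  \int[P]_w hinge (dotp v (X w) - s) <= \int[Q]_w hinge (dotp v (cG w) - s).
Proof.
move=> v1 s0.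
rewrite [leRHS]/Rintegral (integral_hinge_dotp_gaussian gG s (@c0_gt0 R) v1).
apply: Rintegral_hinge_le_stoploss => // t t_ge0.
exact: tX.
Qed.

Let hinge_unit v (s : R) : norm2 v = 1 ->
  \int[P]_w hinge (dotp v (X w) - s) <= \int[Q]_w hinge (dotp v (cG w) - s).
Proof.
move=> v1; have [s0|/ltW s0] := leP 0 s; first exact: hinge_unit_ge0.
rewrite (Rintegral_hinge_reflect s (iY v) (Y0 v)) (Rintegral_hinge_reflect s (iZ v) (Z0 v)) lerD2r.
have Nv1 : norm2 (scalev (-1) v) = 1 by rewrite norm2_scale normrN normr1 mul1r.
have := hinge_unit_ge0 Nv1 (s := - s); rewrite oppr_ge0 => /(_ s0).
by under eq_Rintegral do rewrite dotp_scalel; under [leRHS]eq_Rintegral do rewrite dotp_scalel.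
Qed.

Lemma hinge_dotp_le u (b : R) :
  \int[P]_w hinge (dotp u (X w) + b) <= \int[Q]_w hinge (dotp u (cG w) + b).
Proof.
have [u0|u0] := eqVneq (norm2 u) 0.
  under eq_Rintegral do rewrite norm2_eq0// add0r.
  under [leRHS]eq_Rintegral do rewrite norm2_eq0// add0r.
  rewrite !Rintegral_cst// [X in fine X](probability_setT P).
  by rewrite [X in _ <= _ * fine X](probability_setT Q).
have n0 : 0 < norm2 u by rewrite lt_neqAle eq_sym u0 sqrtr_ge0.
pose v := scalev (norm2 u)^-1 u; pose s := - b / norm2 u.
have v1 : norm2 v = 1 by rewrite norm2_scale normfV gtr0_norm// mulVf.
have E x : hinge (dotp u x + b) = norm2 u * hinge (dotp v x - s).
  by rewrite -hingeM ?ltW// /v /s dotp_scalel; congr hinge; field.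
under eq_Rintegral do rewrite E; under [leRHS]eq_Rintegral do rewrite E.
have iH d0 (T0 : measurableType d0) (P0 : probability T0 R) (y : T0 -> R) :
    P0.-integrable setT (EFin \o y) -> P0.-integrable setT (EFin \o (fun w => hinge (y w - s))).
  move=> iy; apply: integrable_hinge.
  by have := integrable_affine 1 (- s) iy; under eq_fun do rewrite mul1r.
rewrite !RintegralZl//; [|exact: iH|exact: iH].
by rewrite ler_pM2l// hinge_unit.
Qed.

(** With a finite expectation common to both laws, [l] can be subtracted from [g] without meeting a
    difference of infinities. *)
Definition balanced_minorant (g l : d.-tuple R -> R) : Prop :=
  [/\ forall x, l x <= g x,
      P.-integrable setT (EFin \o (fun w => l (X w))),
      Q.-integrable setT (EFin \o (fun w => l (cG w))) &
      \int[P]_w l (X w) = \int[Q]_w l (cG w)].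

Lemma ridge_convex_comparison g : ridge_convex g ->
  exists l, [/\ measurable_fun setT g, measurable_fun setT l, balanced_minorant g l &
    (\int[P]_w (g (X w) - l (X w))%:E <= \int[Q]_w (g (cG w) - l (cG w))%:E)%E].
Proof.
move=> [m [a [b [u [lam [phi [lam0 cvx gE]]]]]]].
pose t k y := tangent (cvx k) 0 y.
pose l x := b + dotp a x + \sum_(k < m) lam k * t k (dotp (u k) x).
exists l.
have mphi k : measurable_fun setT (phi k) := measurable_convex (cvx k).
have mt k : measurable_fun setT (t k) := measurable_tangent (cvx k) 0.
have mh (h : 'I_m -> R -> R) : (forall k, measurable_fun setT (h k)) ->
    measurable_fun setT (fun x : d.-tuple R => b + dotp a x + \sum_(k < m) lam k * h k (dotp (u k) x)).
  move=> mh; apply: measurable_funD.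
    by apply: measurable_funD => //; exact: measurable_dotp.
  apply: (@measurable_sum _ _ R _ _ _
    (fun (k : 'I_m) (x : d.-tuple R) => lam k * h k (dotp (u k) x))) => k.
  apply: measurable_funM => //; apply: measurableT_comp => //; exact: measurable_dotp.
have glE x : g x - l x = \sum_(k < m) lam k * (phi k (dotp (u k) x) - t k (dotp (u k) x)).
  rewrite gE /l opprD addrACA subrr add0r -sumrB.
  by apply: eq_bigr => k _; rewrite mulrBr.
have term0 k y : 0 <= lam k * (phi k y - t k y) by rewrite mulr_ge0// subr_ge0 tangent_le.
split.
- have -> : g = (fun x => b + dotp a x + \sum_(k < m) lam k * phi k (dotp (u k) x)) by exact/funext.
  exact: (mh phi mphi).
- exact: (mh t mt).
(* Replacing each [phi k] by its tangent at [0] makes [l] affine; [a'] gathers its linear part and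
   [K] is its mean under both laws. *)
- pose a' := [tuple tnth a i + \sum_(k < m) lam k * subgradient (cvx k) 0 * tnth (u k) i | i < d].
  pose K := b + \sum_(k < m) lam k * phi k 0.
  have lE x : l x = 1 * dotp a' x + K.
    have -> : dotp a' x = dotp a x + \sum_(k < m) lam k * subgradient (cvx k) 0 * dotp (u k) x.
      rewrite /dotp; under [X in _ = _ + X]eq_bigr do rewrite mulr_sumr.
      rewrite exchange_big -big_split/=; apply: eq_bigr => i _.
      rewrite tnth_mktuple mulrDl mulr_suml; congr (_ + _).
      by apply: eq_bigr => k _; rewrite mulrA.
    rewrite /l /K mul1r [b + _]addrC -!addrA; congr (_ + _).
    rewrite addrCA; congr (_ + _); rewrite -big_split/=; apply: eq_bigr => k _.
    by rewrite /t /tangent subr0; ring.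
  have EP : (fun w => l (X w)) = (fun w => 1 * dotp a' (X w) + K) by exact/funext.
  have EQ : (fun w => l (cG w)) = (fun w => 1 * dotp a' (cG w) + K) by exact/funext.
  split.
  + by move=> x; rewrite -subr_ge0 glE sumr_ge0.
  + by rewrite EP; exact: integrable_affine.
  + by rewrite EQ; exact: integrable_affine.
  + by rewrite EP EQ !Rintegral_affine// Y0 Z0.
- have sumE d0 (T0 : measurableType d0) (P0 : probability T0 R) (y : T0 -> d.-tuple R) :
      measurable_fun setT y ->
      (\int[P0]_w (g (y w) - l (y w))%:E = \sum_(k < m) (lam k)%:E *
        \int[P0]_w (phi k (dotp (u k) (y w)) - t k (dotp (u k) (y w)))%:E)%E.
    move=> my; have mk k : measurable_fun setT
        (fun w => phi k (dotp (u k) (y w)) - t k (dotp (u k) (y w))).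
      have mdk : measurable_fun setT (fun w => dotp (u k) (y w)).
        by apply: measurableT_comp my; exact: measurable_dotp.
      by apply: measurable_funB; exact: measurableT_comp.
    under eq_integral do rewrite glE -sumEFin.
    rewrite ge0_integral_sum//=; last 2 first.
    + by move=> k; apply/measurable_EFinP; exact: measurable_funM.
    + by move=> k w _; rewrite lee_fin.
    apply: eq_bigr => k _; under eq_integral do rewrite EFinM.
    rewrite ge0_integralZl//; last 2 first.
    + by move=> w _; rewrite lee_fin subr_ge0 tangent_le.
    + by rewrite lee_fin.
    exact/measurable_EFinP.
  rewrite !sumE; last 2 first.
  + by apply: measurableT_comp; [exact: measurable_scalev|exact: measurable_funPT].
  + exact: measurable_funPT.
  apply: lee_sum => k _; apply: lee_wpmul2l; first by rewrite lee_fin.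
  apply: convex_domination => // [|al be]; first by rewrite Y0 Z0.
  under eq_Rintegral do rewrite -dotp_scalel.
  under [leRHS]eq_Rintegral do rewrite -dotp_scalel.
  exact: hinge_dotp_le.
Qed.

Lemma balanced_minorant_expectation g l : measurable_fun setT g -> balanced_minorant g l ->
  [/\ ('E_P[fun w => g (X w)] = \int[P]_w (g (X w) - l (X w))%:E + (\int[P]_w l (X w))%:E)%E,
      ('E_Q[fun w => g (cG w)] = \int[Q]_w (g (cG w) - l (cG w))%:E + (\int[P]_w l (X w))%:E)%E,
      (0 <= \int[P]_w (g (X w) - l (X w))%:E)%E &
      (0 <= \int[Q]_w (g (cG w) - l (cG w))%:E)%E].
Proof.
move=> mg [lg iP iQ PQ]; rewrite unlock; split.
- apply: integral_minorant => //; apply: measurableT_comp => //; exact: measurable_funPT.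
- rewrite PQ; apply: integral_minorant => //; apply: measurableT_comp => //.
  by apply: measurableT_comp; [exact: measurable_scalev|exact: measurable_funPT].
- by apply: integral_ge0 => w _; rewrite lee_fin subr_ge0.
- by apply: integral_ge0 => w _; rewrite lee_fin subr_ge0.
Qed.

Lemma limit_comparison f : measurable_fun setT f ->
  ridge_convex f \/ increasing_limit_ridge_convex f ->
  exists l, balanced_minorant f l /\
    (\int[P]_w (f (X w) - l (X w))%:E <= \int[Q]_w (f (cG w) - l (cG w))%:E)%E.
Proof.
move=> mf [/ridge_convex_comparison[l [_ _ bl le1]]|[g [rg ndg gf]]]; first by exists l.
(* The minorant of [g 0] serves for every [g n] and for [f], by monotonicity. *)
have [l [_ ml [lg0 iP iQ PQ] _]] := ridge_convex_comparison (rg 0%N).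
have g0g n x : g 0%N x <= g n x by exact: ndg.
have gfx n x : g n x <= f x.
  have cx : cvgn (fun n => g n x) by apply/cvg_ex; exists (f x); exact: gf.
  by rewrite -(cvg_lim (@Rhausdorff R) (gf x)); exact: nondecreasing_cvgn_le.
have lgn n x : l x <= g n x by exact: le_trans (lg0 x) (g0g n x).
have mX : measurable_fun setT X by exact: measurable_funPT.
have mcG : measurable_fun setT cG.
  by apply: measurableT_comp; [exact: measurable_scalev|exact: measurable_funPT].
exists l; split.
  by split => // x; exact: le_trans (lg0 x) (gfx 0%N x).
have mg n : measurable_fun setT (g n) by have [? []] := ridge_convex_comparison (rg n).
apply: (@integral_cvg_le _ T R P (fun n w => g n (X w) - l (X w))).
- by move=> n; apply: measurable_funB; exact: measurableT_comp.
- by move=> n w; rewrite subr_ge0.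
- by move=> w; apply: cvgB; [exact: gf|exact: cvg_cst].
move=> n; apply: (@le_trans _ _ (\int[Q]_w (g n (cG w) - l (cG w))%:E)%E); last first.
  apply: ge0_le_integral => //.
  - by move=> w _; rewrite lee_fin subr_ge0.
  - by apply/measurable_EFinP; apply: measurable_funB; exact: measurableT_comp.
  - by apply/measurable_EFinP; apply: measurable_funB; exact: measurableT_comp.
  - by move=> w _; rewrite lee_fin lerD2r.
have bl : balanced_minorant (g n) l by split.
have [E1 E2 _ _] := balanced_minorant_expectation (mg n) bl.
(* The comparison for [g n] comes with its own minorant [l']; it is turned into one of expectations,
   then back into one relative to [l] by cancelling a finite term. *)
have [l' [_ _ bl' le']] := ridge_convex_comparison (rg n).
have [E1' E2' _ _] := balanced_minorant_expectation (mg n) bl'.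
have : ('E_P[fun w => g n (X w)] <= 'E_Q[fun w => g n (cG w)])%E.
  by rewrite E1' E2' leeD2r.
by rewrite E1 E2 leeD2rE.
Qed.

End Comparison.

Theorem theorem22 (R : realType) (d : nat)
    (dT : measure_display) (T : measurableType dT) (P : probability T R)
    (X : {RV P >-> d.-tuple R})
    (dS : measure_display) (S : measurableType dS) (Q : probability S R)
    (G : {RV Q >-> d.-tuple R})
    (f : d.-tuple R -> R) :
  integrable_vector P X ->
  centered P X ->
  subgaussian_tails P X ->
  standard_gaussian Q G ->
  measurable_fun [set: d.-tuple R] f ->
  ridge_convex f \/ increasing_limit_ridge_convex f ->
  [/\ (-oo < 'E_P[fun w => f (X w)])%E,
      (-oo < 'E_Q[fun w => f (scalev (c0 R) (G w))])%E
    & ('E_P[fun w => f (X w)] <= 'E_Q[fun w => f (scalev (c0 R) (G w))])%E].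
Proof.
move=> iX cX tX gG mf rf.
have [l [bl le1]] := limit_comparison iX cX tX gG mf rf.
have [-> -> p0 q0] := balanced_minorant_expectation mf bl.
split; last by rewrite leeD2r.
- by rewrite (lt_le_trans (ltNyr (\int[P]_w l (X w))))// leeDr.
- by rewrite (lt_le_trans (ltNyr (\int[P]_w l (X w))))// leeDr.
Qed.
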